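(* Consider the flow equation $$\dot y^1=y^1(y^2-y^3),\quad \dot y^2=y^2(y^3-y^1),\quad \dot y^3=y^3(y^1-y^2)$$ on $\{y^1,y^2,y^3>0,\ y^1+y^2+y^3=1\}$, and let $c_3=y^1y^2y^3$ (a conserved quantity), with $0<c_3<1/27$. The flow equation is solved by $$y^k(t)=\frac{c_3}{\frac1{12}-\wp(t+k t_\infty)},\qquad k=1,2,3,$$ where $\wp$ is the Weierstrass elliptic function with half-periods $\omega_1,\omega_2$ of a rectangular lattice and $t_\infty=\frac23\omega_1$, and where $t$ has constant imaginary part $-i\omega_2$ and arbitrary real part (i.e. $t\in\omega_2+\mathbb{R}$, time being the real part of $t$; every solution with the given value of $c_3$ is of this form after a real translation of time).
   Context: For $c_3\in(0,1/27)$ put $g_2=\frac1{12}-2c_3$, $g_3=\frac{c_3}{6}-\frac1{216}-c_3^2$. $\wp$ denotes the Weierstrass function with $(\wp')^2=4\wp^3-g_2\wp-g_3$, whose period lattice is $2\omega_1\mathbb{Z}+2\omega_2\mathbb{Z}$. The discriminant $c_3^3(1-27c_3)$ is positive, so the half-periods can be and are normalised by $\omega_1>0$, $\omega_2\in i\mathbb{R}_{>0}$. *)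

(* Defs.v *)
From Stdlib Require Export Reals ZArith.
From Coquelicot Require Export Coquelicot.

Open Scope R_scope.

(** Throughout, [w1] and [w2] are half-periods, not periods. *)

Definition lattice_point (w1 w2 : C) (m n : Z) : C :=
  (2 * RtoC (IZR m) * w1 + 2 * RtoC (IZR n) * w2)%C.

Definition in_lattice (w1 w2 z : C) : Prop :=
  exists m n : Z, z = lattice_point w1 w2 m n.

Definition wp_term (w1 w2 z : C) (m n : Z) : C :=
  if andb (Z.eqb m 0) (Z.eqb n 0) then (/ (z * z))%C
  else
    let l := lattice_point w1 w2 m n in
    (/ ((z - l) * (z - l)) - / (l * l))%C.

(** Sum of the terms with [-N <= m, n <= N].  Off the lattice the double
    series converges absolutely, so that exhausting Z^2 by these squares gives
    its (unordered) sum. *)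
Definition wp_partial (w1 w2 z : C) (N : nat) : C :=
  sum_n (fun i : nat => sum_n (fun j : nat =>
    wp_term w1 w2 z (Z.of_nat i - Z.of_nat N) (Z.of_nat j - Z.of_nat N))
    (2 * N)) (2 * N).

(** [Lim_seq] is total, so the value is meaningless at lattice points, where
    the Weierstrass function has its poles. *)
Definition wp (w1 w2 z : C) : C :=
  (real (Lim_seq (fun N : nat => Re (wp_partial w1 w2 z N))),
   real (Lim_seq (fun N : nat => Im (wp_partial w1 w2 z N)))).

(** [d] is the complex derivative; the condition says that the lattice
    2 w1 Z + 2 w2 Z has invariants [g2] and [g3]. *)
Definition weierstrass_equation (w1 w2 : C) (g2 g3 : R) : Prop :=
  forall z : C, ~ in_lattice w1 w2 z ->
    exists d : C,
      @is_derive C_AbsRing C_NormedModule (wp w1 w2) z d /\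
      (d * d = 4 * (wp w1 w2 z * wp w1 w2 z * wp w1 w2 z)
               - RtoC g2 * wp w1 w2 z - RtoC g3)%C.

Definition g2_of (c3 : R) : R := 1 / 12 - 2 * c3.
Definition g3_of (c3 : R) : R := c3 / 6 - 1 / 216 - c3 ^ 2.

Definition in_domain (y1 y2 y3 : R) : Prop :=
  0 < y1 /\ 0 < y2 /\ 0 < y3 /\ y1 + y2 + y3 = 1.

Definition in_interval (a b : Rbar) (t : R) : Prop :=
  Rbar_lt a t /\ Rbar_lt t b.

Definition flow_solution (a b : Rbar) (y1 y2 y3 : R -> R) : Prop :=
  forall t : R, in_interval a b t ->
    in_domain (y1 t) (y2 t) (y3 t) /\
    is_derive y1 t (y1 t * (y2 t - y3 t)) /\
    is_derive y2 t (y2 t * (y3 t - y1 t)) /\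
    is_derive y3 t (y3 t * (y1 t - y2 t)).

Definition conserved_value (a b : Rbar) (y1 y2 y3 : R -> R) (c3 : R) : Prop :=
  forall t : R, in_interval a b t -> y1 t * y2 t * y3 t = c3.

(** The shift between consecutive components is a third of the real period. *)
Definition y_formula (c3 w1 : R) (w2 : C) (k : nat) (t : C) : C :=
  (RtoC c3 /
   (RtoC (1 / 12) - wp (RtoC w1) w2 (t + RtoC (INR k * (2 / 3 * w1)))))%C.

(** Each equation in C also asserts that the formula is real on the line
    w2 + R; [s] is a translation of time. *)
Definition given_by_formula (c3 w1 : R) (w2 : C) (s : R) (a b : Rbar)
    (y1 y2 y3 : R -> R) : Prop :=
  forall t : R, in_interval a b t ->
    RtoC (y1 t) = y_formula c3 w1 w2 1 (w2 + RtoC (t + s))%C /\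
    RtoC (y2 t) = y_formula c3 w1 w2 2 (w2 + RtoC (t + s))%C /\
    RtoC (y3 t) = y_formula c3 w1 w2 3 (w2 + RtoC (t + s))%C.

(* Main.v *)
From Stdlib Require Import Reals ZArith Lra Lia Psatz.
From Coquelicot Require Import Coquelicot.
Require Import Defs.

(** Put [u t = 1/12 - wp (w2 + t)]. On the line [w2 + R] the Weierstrass function
    is real, so [u] is a real function, even, of period [2 w1], and in terms of
    [u] the Weierstrass equation and its derivative read
    [u'^2 = (u - c)^2 - 4 u^3] and [u'' = u - c - 6 u^2].

    The flow has the same content. On a flow line with [y1 y2 y3 = c], the
    function [y2 y3 = c / y1] satisfies exactly these two equations
    ([flow_reduced]), and [y2], [y3] are recovered from it and its derivative;
    hence [u] yields a flow line [(eta1, eta2, eta3)] with [eta1 = c / u]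
    ([eta_flow]). In the region [u > c] the first equation describes one closed
    curve, which [u] runs through ([orbit_transitive]); so, by uniqueness for the
    second equation, every flow line of product [c] is a translate of
    [(eta1, eta2, eta3)] ([flow_is_shift]).

    The shift by a third of a period comes from a symmetry. Permuting the
    components cyclically preserves the flow, so it acts on the orbit as a
    translation by some [tau] ([eta_cyclic]), and [3 tau] is a period. If the
    least period is [2 w1], then [tau] is [0], [2 w1 / 3] or [4 w1 / 3] up to
    periods. The first would force [u' = 0]; the last would make the orbit run
    backwards ([eta_third]).

    Two facts about the Weierstrass function itself remain. The second-order
    equation does not follow from the first-order one, which has constant
    solutions too. With [E = wp'' - 6 wp^2 + g2/2], the derivative of the first
    equation gives [wp' E = 0]. Differentiating this product twice gives
    [wp'' E = 0] and [wp''' E = 0], so [E E' = 0] and [E^2] is constant on rays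
    from the origin; it vanishes near the pole, where [wp'] has no zero
    ([P2_equation]). Secondly, no [q] with [0 < q < 2 w1] is a period of [u]:
    by uniqueness for the second-order equation along the imaginary axis,
    [wp] and its translate by [q] would then agree on the segment from [w2] to
    the pole at [0], although [q] is not a pole ([no_short_period]).

    All this rests on the double series: it is dominated, together with its
    termwise derivatives, by a product of two convergent series, which gives
    convergence and differentiability ([series_Cder]); its symmetries are read
    off from the sums over squares, where a shift by a period changes only two
    sides of the square ([box_shift_fst], [box_shift_snd]). *)

(** * Sums over symmetric squares of Z^2 *)

(** Pairing the indices [k] and [-k] lets sums over [-N..N] be handled by
    induction on [N]. *)
Fixpoint sumZ (g : Z -> R) (N : nat) : R :=
  match N with
  | O => g 0%Z
  | S k => sumZ g k + (g (Z.of_nat N) + g (- Z.of_nat N)%Z)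
  end.

Definition box (a : Z -> Z -> R) (N : nat) : R :=
  sumZ (fun m => sumZ (a m) N) N.

Lemma sum_n_sumZ (g : Z -> R) (N : nat) :
  sum_n (fun i => g (Z.of_nat i - Z.of_nat N)%Z) (2 * N) = sumZ g N.
Proof.
  induction N as [|N IH].
  - now rewrite sum_O.
  - replace (2 * S N)%nat with (S (S (2 * N))) by lia.
    rewrite sum_Sn. unfold sum_n. rewrite sum_Sn_m by lia.
    rewrite <- sum_n_m_S.
    rewrite (sum_n_m_ext _ (fun i => g (Z.of_nat i - Z.of_nat N)%Z)).
    2:{ intros k. f_equal. lia. }
    change (sum_n_m (fun i => g (Z.of_nat i - Z.of_nat N)%Z) 0 (2 * N))
      with (sum_n (fun i => g (Z.of_nat i - Z.of_nat N)%Z) (2 * N)).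
    rewrite IH. cbn [sumZ]. unfold plus; cbn -[Z.of_nat].
    replace (Z.of_nat 0 - Z.of_nat (S N))%Z with (- Z.of_nat (S N))%Z by lia.
    replace (Z.of_nat (S (S (N + (N + 0)))) - Z.of_nat (S N))%Z
      with (Z.of_nat (S N)) by lia.
    ring.
Qed.

Lemma sumZ_ext (f g : Z -> R) N : (forall m, f m = g m) -> sumZ f N = sumZ g N.
Proof. intros H; induction N; cbn [sumZ]; rewrite ?IHN, !H; auto. Qed.

Lemma sumZ_plus (f g : Z -> R) N :
  sumZ (fun m => f m + g m) N = sumZ f N + sumZ g N.
Proof. induction N; cbn [sumZ]; [|rewrite IHN]; ring. Qed.

Lemma sumZ_scal x (f : Z -> R) N : sumZ (fun m => x * f m) N = x * sumZ f N.
Proof. induction N; cbn [sumZ]; [|rewrite IHN]; ring. Qed.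

Lemma sumZ_le (f g : Z -> R) N :
  (forall m, f m <= g m) -> sumZ f N <= sumZ g N.
Proof.
  intros H; induction N; cbn [sumZ]; auto.
  pose proof (H (Z.of_nat (S N))). pose proof (H (- Z.of_nat (S N))%Z). lra.
Qed.

Lemma sumZ_abs (f : Z -> R) N : Rabs (sumZ f N) <= sumZ (fun m => Rabs (f m)) N.
Proof.
  induction N; cbn [sumZ]; [lra|].
  eapply Rle_trans; [apply Rabs_triang|]. apply Rplus_le_compat; auto.
  apply Rabs_triang.
Qed.

Lemma sumZ_flip (f : Z -> R) N : sumZ (fun m => f (- m)%Z) N = sumZ f N.
Proof.
  induction N; cbn [sumZ]; [reflexivity|]. rewrite IHN, Z.opp_involutive. ring.
Qed.

Lemma sumZ_ge0 (f : Z -> R) N : (forall m, 0 <= f m) -> 0 <= sumZ f N.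
Proof.
  intros H; induction N; cbn [sumZ]; auto.
  pose proof (H (Z.of_nat (S N))). pose proof (H (- Z.of_nat (S N))%Z). lra.
Qed.

Lemma sumZ_incr (f : Z -> R) N :
  (forall m, 0 <= f m) -> sumZ f N <= sumZ f (S N).
Proof.
  intros H; cbn [sumZ].
  pose proof (H (Z.of_nat (S N))). pose proof (H (- Z.of_nat (S N))%Z). lra.
Qed.

Lemma sumZ_telescope (f : Z -> R) N :
  sumZ (fun m => f (m + 1)%Z - f m) N = f (Z.of_nat N + 1)%Z - f (- Z.of_nat N)%Z.
Proof.
  induction N; [reflexivity|]. cbn [sumZ]. rewrite IHN.
  replace (- Z.of_nat (S N) + 1)%Z with (- Z.of_nat N)%Z by lia.
  replace (Z.of_nat N + 1)%Z with (Z.of_nat (S N)) by lia. ring.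
Qed.

Lemma sumZ_delta (f : Z -> R) N :
  (forall m, m <> 0%Z -> f m = 0) -> sumZ f N = f 0%Z.
Proof.
  intros H; induction N; [reflexivity|]. cbn [sumZ].
  rewrite IHN, (H (Z.of_nat (S N))), (H (- Z.of_nat (S N))%Z) by lia. ring.
Qed.

Lemma box_ext a c N : (forall m n, a m n = c m n) -> box a N = box c N.
Proof. intros H. apply sumZ_ext; intros m. now apply sumZ_ext. Qed.

Lemma box_plus a c N : box (fun m n => a m n + c m n) N = box a N + box c N.
Proof.
  unfold box. rewrite <- sumZ_plus. apply sumZ_ext; intros m. apply sumZ_plus.
Qed.

Lemma box_scal x a N : box (fun m n => x * a m n) N = x * box a N.
Proof.
  unfold box. rewrite <- sumZ_scal. apply sumZ_ext; intros m. apply sumZ_scal.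
Qed.

Lemma box_le a c N : (forall m n, a m n <= c m n) -> box a N <= box c N.
Proof. intros H. apply sumZ_le; intros m. now apply sumZ_le. Qed.

Lemma box_incr a N : (forall m n, 0 <= a m n) -> box a N <= box a (S N).
Proof.
  intros H. unfold box.
  apply Rle_trans with (sumZ (fun m => sumZ (a m) (S N)) N).
  - apply sumZ_le; intros m. now apply sumZ_incr.
  - apply (sumZ_incr (fun m => sumZ (a m) (S N))). intros m.
    apply sumZ_ge0. auto.
Qed.

Lemma box_prod (f g : Z -> R) N :
  box (fun m n => f m * g n) N = sumZ f N * sumZ g N.
Proof.
  unfold box.
  rewrite (sumZ_ext _ (fun m => sumZ g N * f m)).
  - rewrite sumZ_scal. ring.
  - intros m. rewrite sumZ_scal. ring.
Qed.

(** ** Domination *)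

Definition absZ (m : Z) : R := Rabs (IZR m).

(** The exponent 3/2 is chosen so that [weight m * weight n] is summable over Z^2
    while still dominating [(1 + |m| + |n|)^-3], the size of the cubic terms. *)
Definition weight (m : Z) : R := / ((1 + absZ m) * sqrt (1 + absZ m)).

Lemma absZ_ge0 m : 0 <= absZ m.
Proof. apply Rabs_pos. Qed.

Lemma absZ_opp m : absZ (- m) = absZ m.
Proof. unfold absZ. now rewrite opp_IZR, Rabs_Ropp. Qed.

Lemma absZ_nat k : absZ (Z.of_nat k) = INR k.
Proof. unfold absZ. rewrite <- INR_IZR_INZ. apply Rabs_pos_eq, pos_INR. Qed.

Lemma weight_gt0 m : 0 < weight m.
Proof.
  pose proof (absZ_ge0 m). apply Rinv_0_lt_compat, Rmult_lt_0_compat; [lra|].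
  apply sqrt_lt_R0; lra.
Qed.

(** Comparison with the telescoping series of [1 / sqrt k - 1 / sqrt (k + 1)];
    the second term of the bound is what the induction needs. *)
Lemma sumZ_weight N : sumZ weight N <= 5 - 4 / sqrt (1 + INR N).
Proof.
  induction N.
  - cbn. unfold weight, absZ. rewrite Rabs_R0, !Rplus_0_r, sqrt_1. lra.
  - cbn [sumZ].
    assert (E : weight (- Z.of_nat (S N)) = weight (Z.of_nat (S N)))
      by (unfold weight; now rewrite absZ_opp).
    rewrite E. unfold weight at 2 3. rewrite absZ_nat, S_INR.
    pose proof (pos_INR N) as HN.
    set (x := sqrt (1 + INR N)) in *. set (y := sqrt (1 + (INR N + 1))).
    assert (Hx : 0 < x) by (apply sqrt_lt_R0; lra).
    assert (Hy : 0 < y) by (apply sqrt_lt_R0; lra).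
    assert (Hxx : x * x = 1 + INR N) by (apply sqrt_sqrt; lra).
    assert (Hyy : y * y = 1 + (INR N + 1)) by (apply sqrt_sqrt; lra).
    rewrite <- Hyy.
    assert (Hxy : x < y) by nra.
    assert (K : / (y * y * y) <= 2 * (/ x - / y)).
    { apply Rmult_le_reg_r with (x * (y * y * y)); [repeat apply Rmult_lt_0_compat; lra|].
      replace (/ (y * y * y) * (x * (y * y * y))) with x by (field; lra).
      replace (2 * (/ x - / y) * (x * (y * y * y))) with (2 * (y - x) * (y * y))
        by (field; lra).
      assert (y * y = x * x + 1) by lra.
      assert ((y - x) * (y + x) = 1) by nra.
      assert (0 < y - x) by lra.
      assert (2 * (y - x) * y >= 1) by nra. nra. }
    unfold Rdiv in *. lra.
Qed.

Lemma sumZ_weight_le N : 0 <= sumZ weight N <= 5.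
Proof.
  split.
  - apply sumZ_ge0; intros m. pose proof (weight_gt0 m). lra.
  - pose proof (sumZ_weight N).
    assert (0 < 4 / sqrt (1 + INR N)).
    { apply Rdiv_lt_0_compat; [lra|]. apply sqrt_lt_R0. pose proof (pos_INR N). lra. }
    lra.
Qed.

Definition dominated (K : R) (a : Z -> Z -> R) : Prop :=
  forall m n, Rabs (a m n) <= K * (weight m * weight n).

Lemma dominated_ge0 K a : dominated K a -> 0 <= K.
Proof.
  intros H. specialize (H 0%Z 0%Z). pose proof (Rabs_pos (a 0%Z 0%Z)).
  pose proof (Rmult_lt_0_compat _ _ (weight_gt0 0) (weight_gt0 0)).
  destruct (Rle_lt_dec 0 K); auto. nra.
Qed.

Lemma box_dominated K a N : dominated K a -> Rabs (box a N) <= 25 * K.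
Proof.
  intros H. pose proof (dominated_ge0 _ _ H) as HK.
  assert (E : box (fun m n => K * (weight m * weight n)) N <= 25 * K).
  { rewrite box_scal, box_prod. destruct (sumZ_weight_le N) as [B0 B5].
    assert (sumZ weight N * sumZ weight N <= 5 * 5) by (apply Rmult_le_compat; lra).
    rewrite (Rmult_comm 25). apply Rmult_le_compat_l; lra. }
  apply Rabs_le. split.
  - assert (box (fun m n => -1 * (K * (weight m * weight n))) N <= box a N).
    { apply box_le; intros m n. specialize (H m n).
      apply Rabs_le_between in H. lra. }
    rewrite box_scal in H0. lra.
  - eapply Rle_trans; [|apply E]. apply box_le; intros m n. specialize (H m n).
    apply Rabs_le_between in H. lra.
Qed.

Definition box_lim (a : Z -> Z -> R) : R := real (Lim_seq (box a)).

(** [a + c], with [c] the dominating family, is nonnegative, so that its box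
    sums increase. *)
Lemma box_cv K a : dominated K a -> is_lim_seq (box a) (box_lim a).
Proof.
  intros H. pose proof (dominated_ge0 _ _ H) as HK.
  set (c := fun m n => K * (weight m * weight n)).
  assert (Hc0 : forall m n, 0 <= c m n).
  { intros m n. unfold c. pose proof (weight_gt0 m). pose proof (weight_gt0 n).
    apply Rmult_le_pos; [lra|]. apply Rmult_le_pos; lra. }
  assert (Hc : dominated K c).
  { intros m n. rewrite Rabs_pos_eq; [apply Rle_refl|apply Hc0]. }
  assert (C1 : ex_finite_lim_seq (box c)).
  { apply ex_finite_lim_seq_incr with (25 * K).
    - intros N. now apply box_incr.
    - intros N. pose proof (box_dominated _ _ N Hc) as B. apply Rabs_le_between in B. lra. }
  assert (C2 : ex_finite_lim_seq (box (fun m n => a m n + c m n))).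
  { apply ex_finite_lim_seq_incr with (25 * K + 25 * K).
    - intros N. apply box_incr. intros m n. specialize (H m n). fold (c m n) in H.
      apply Rabs_le_between in H. lra.
    - intros N. rewrite box_plus. pose proof (box_dominated _ _ N Hc) as B.
      pose proof (box_dominated _ _ N H) as B'. apply Rabs_le_between in B.
      apply Rabs_le_between in B'. lra. }
  apply Lim_seq_correct'.
  destruct C1 as [l1 C1], C2 as [l2 C2]. exists (l2 - l1).
  eapply is_lim_seq_ext; [|apply (is_lim_seq_minus' _ _ _ _ C2 C1)].
  intros N. cbn. rewrite box_plus. ring.
Qed.

Lemma box_lim_unique a l : is_lim_seq (box a) (Finite l) -> box_lim a = l.
Proof. intros H. unfold box_lim. now rewrite (is_lim_seq_unique _ _ H). Qed.

Lemma box_lim_le K a : dominated K a -> Rabs (box_lim a) <= 25 * K.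
Proof.
  intros H. pose proof (box_cv _ _ H) as L.
  apply (is_lim_seq_le (fun N => Rabs (box a N)) (fun _ => 25 * K) (Rabs (box_lim a)) (25 * K)).
  - intros N. now apply box_dominated.
  - now apply (is_lim_seq_abs _ (box_lim a)).
  - apply is_lim_seq_const.
Qed.

(** * Complex derivatives *)

(** The structure on C whose balls are given by the modulus; unlike the one whose
    balls are products of intervals, it supports the product rule. *)
Definition Cder : (C -> C) -> C -> C -> Prop :=
  @is_derive C_AbsRing (AbsRing_NormedModule C_AbsRing).

Lemma Cplus_minus (z y : C) : (z + (y - z) = y)%C.
Proof. ring. Qed.

Lemma Cder_intro (f : C -> C) (z d : C) :
  (forall eps : R, 0 < eps -> exists delta : R, 0 < delta /\
     forall h : C, Cmod h < delta ->
       Cmod (f (z + h) - f z - h * d)%C <= eps * Cmod h) ->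
  Cder f z d.
Proof.
  intros H. split; [apply is_linear_scal_l|].
  intros x Hx eps.
  apply (@is_filter_lim_locally_unique C_AbsRing (AbsRing_NormedModule C_AbsRing)) in Hx.
  subst x.
  destruct (H eps (cond_pos eps)) as (delta & Hd & Hh).
  exists (mkposreal delta Hd). intros y Hy.
  specialize (Hh (Cminus y z) Hy). rewrite Cplus_minus in Hh.
  exact Hh.
Qed.

(** Both structures on C have the same norm, so a derivative in either sense
    satisfies the same estimate. *)
Lemma Cder_elim (f : C -> C) (z d : C) :
  (Cder f z d \/ @is_derive C_AbsRing C_NormedModule f z d) ->
  forall eps : R, 0 < eps -> exists delta : R, 0 < delta /\
     forall h : C, Cmod h < delta ->
       Cmod (f (z + h) - f z - h * d)%C <= eps * Cmod h.
Proof.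
  intros H eps Heps.
  assert (L : locally (T := AbsRing_UniformSpace C_AbsRing) z
      (fun y => Cmod (f y - f z - (y - z) * d)%C <= eps * Cmod (y - z)%C)).
  { destruct H as [[_ H]|[_ H]];
      exact (H z (fun P HP => HP) (mkposreal eps Heps)). }
  destruct L as [delta Hd]. exists delta. split; [apply cond_pos|].
  intros h Hh. specialize (Hd (z + h)%C).
  replace (z + h - z)%C with h in Hd by ring. apply Hd.
  change (Cmod (z + h + - z)%C < delta). now replace (z + h + - z)%C with h by ring.
Qed.

(** Along a real line a complex derivative yields real derivatives of the real and
    imaginary parts, to which the mean value theorem and uniqueness for real
    systems apply. *)
Lemma Cder_path (f : C -> C) (z0 e d : C) (s : R) :
  (Cder f (z0 + RtoC s * e)%C d \/
   @is_derive C_AbsRing C_NormedModule f (z0 + RtoC s * e)%C d) ->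
  is_derive (fun s => Re (f (z0 + RtoC s * e)%C)) s (Re (e * d)%C) /\
  is_derive (fun s => Im (f (z0 + RtoC s * e)%C)) s (Im (e * d)%C).
Proof.
  intros H.
  assert (G : forall eps : posreal, locally s (fun y =>
    Cmod (f (z0 + RtoC y * e) - f (z0 + RtoC s * e) - RtoC (y - s) * (e * d))%C
      <= eps * Rabs (y - s))).
  { intros eps.
    assert (He : 0 < eps / (1 + Cmod e)).
    { apply Rdiv_lt_0_compat; [apply cond_pos|]. pose proof (Cmod_ge_0 e). lra. }
    destruct (Cder_elim _ _ _ H _ He) as (delta & Hd & Hh).
    assert (Hd' : 0 < delta / (1 + Cmod e)).
    { apply Rdiv_lt_0_compat; [lra|]. pose proof (Cmod_ge_0 e). lra. }
    exists (mkposreal _ Hd'). intros y Hy.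
    change (Rabs (y - s) < delta / (1 + Cmod e)) in Hy.
    pose proof (Cmod_ge_0 e) as He0. pose proof (Rabs_pos (y - s)) as Hy0.
    assert (Hm : Cmod (RtoC (y - s) * e)%C = Rabs (y - s) * Cmod e)
      by now rewrite Cmod_mult, Cmod_R.
    assert (Hy1 : Rabs (y - s) * (1 + Cmod e) < delta).
    { apply Rmult_lt_reg_r with (/ (1 + Cmod e)); [apply Rinv_0_lt_compat; lra|].
      rewrite Rmult_assoc, Rinv_r, Rmult_1_r by lra. exact Hy. }
    specialize (Hh (RtoC (y - s) * e)%C).
    rewrite Hm in Hh.
    replace (z0 + RtoC s * e + RtoC (y - s) * e)%C with (z0 + RtoC y * e)%C in Hh
      by (rewrite RtoC_minus; ring).
    replace (RtoC (y - s) * e * d)%C with (RtoC (y - s) * (e * d))%C in Hh by ring.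
    eapply Rle_trans; [apply Hh; nra|].
    rewrite (Rmult_comm (Rabs _)), <- Rmult_assoc.
    apply Rmult_le_compat_r; [lra|].
    unfold Rdiv. rewrite Rmult_assoc. rewrite <- (Rmult_1_r eps) at 2.
    apply Rmult_le_compat_l; [apply Rlt_le, cond_pos|].
    apply Rmult_le_reg_l with (1 + Cmod e); [lra|].
    rewrite <- Rmult_assoc, Rinv_r by lra. lra. }
  split; (split; [apply is_linear_scal_l|]); intros x Hx eps;
    apply (@is_filter_lim_locally_unique R_AbsRing (AbsRing_NormedModule R_AbsRing)) in Hx;
    subst x;
    destruct (G eps) as [delta Hd]; exists delta; intros y Hy;
    specialize (Hd y Hy);
    (eapply Rle_trans; [|exact Hd]).
  - eapply Rle_trans; [|apply re_le_Cmod]. right.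
    change (Rabs ((Re (f (z0 + RtoC y * e)%C) - Re (f (z0 + RtoC s * e)%C))
      - (y - s) * Re (e * d)%C) =
     Rabs (Re (f (z0 + RtoC y * e) - f (z0 + RtoC s * e) - RtoC (y - s) * (e * d))%C)).
    f_equal. unfold Re, Im; cbn. ring.
  - eapply Rle_trans; [|eapply Rle_trans; [apply Rmax_r|apply Rmax_Cmod]]. right.
    change (Rabs ((Im (f (z0 + RtoC y * e)%C) - Im (f (z0 + RtoC s * e)%C))
      - (y - s) * Im (e * d)%C) =
     Rabs (Im (f (z0 + RtoC y * e) - f (z0 + RtoC s * e) - RtoC (y - s) * (e * d))%C)).
    f_equal. unfold Re, Im; cbn. ring.
Qed.

Lemma Cder_mult (f g : C -> C) (z df dg : C) :
  Cder f z df -> Cder g z dg ->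
  Cder (fun z => f z * g z)%C z (df * g z + f z * dg)%C.
Proof.
  intros Hf Hg.
  apply (@is_derive_mult C_AbsRing f g z df dg Hf Hg). intros n m. apply Cmult_comm.
Qed.

Lemma Cder_plus (f g : C -> C) (z df dg : C) :
  Cder f z df -> Cder g z dg -> Cder (fun z => f z + g z)%C z (df + dg)%C.
Proof. intros Hf Hg. now apply (@is_derive_plus C_AbsRing (AbsRing_NormedModule C_AbsRing)). Qed.

Lemma Cder_const (c z : C) : Cder (fun _ => c) z (RtoC 0).
Proof. apply (@is_derive_const C_AbsRing (AbsRing_NormedModule C_AbsRing)). Qed.

Lemma Cder_unique (f : C -> C) (z d d' : C) :
  (Cder f z d \/ @is_derive C_AbsRing C_NormedModule f z d) -> Cder f z d' -> d = d'.
Proof.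
  intros H H'.
  replace z with (z + RtoC 0 * RtoC 1)%C in H, H' by ring.
  destruct (Cder_path f z (RtoC 1) d 0 H) as [A1 A2].
  destruct (Cder_path f z (RtoC 1) d' 0 (or_introl H')) as [B1 B2].
  apply is_derive_unique in A1, A2, B1, B2. rewrite A1 in B1. rewrite A2 in B2.
  replace (RtoC 1 * d)%C with d in * by ring. replace (RtoC 1 * d')%C with d' in * by ring.
  destruct d, d'. unfold Re, Im in *. cbn in *. now subst.
Qed.

(** * Sums of complex terms over the lattice *)

Definition Cdominated (K : R) (a : Z -> Z -> C) : Prop :=
  forall m n, Cmod (a m n) <= K * (weight m * weight n).

Definition lattice_sum (a : Z -> Z -> C) : C :=
  (box_lim (fun m n => Re (a m n)), box_lim (fun m n => Im (a m n))).

Lemma im_le_Cmod (c : C) : Rabs (Im c) <= Cmod c.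
Proof. eapply Rle_trans; [apply Rmax_r|apply Rmax_Cmod]. Qed.

Lemma Cmod_le_sum (c : C) : Cmod c <= Rabs (Re c) + Rabs (Im c).
Proof.
  replace c with (RtoC (Re c) + Ci * RtoC (Im c))%C at 1.
  - eapply Rle_trans; [apply Cmod_triangle|].
    rewrite Cmod_mult, Cmod_Ci, !Cmod_R. lra.
  - destruct c; unfold Re, Im, Ci, RtoC, Cplus, Cmult; cbn. f_equal; ring.
Qed.

Lemma Cdominated_Re K a : Cdominated K a -> dominated K (fun m n => Re (a m n)).
Proof. intros H m n. eapply Rle_trans; [apply re_le_Cmod|apply H]. Qed.

Lemma Cdominated_Im K a : Cdominated K a -> dominated K (fun m n => Im (a m n)).
Proof. intros H m n. eapply Rle_trans; [apply im_le_Cmod|apply H]. Qed.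

Lemma lattice_sum_ext a c : (forall m n, a m n = c m n) -> lattice_sum a = lattice_sum c.
Proof.
  intros H. unfold lattice_sum, box_lim.
  f_equal; f_equal; apply Lim_seq_ext; intros N; apply box_ext; intros; now rewrite H.
Qed.

Lemma lattice_sum_le K a : Cdominated K a -> Cmod (lattice_sum a) <= 50 * K.
Proof.
  intros H. eapply Rle_trans; [apply Cmod_le_sum|].
  pose proof (box_lim_le _ _ (Cdominated_Re _ _ H)). pose proof (box_lim_le _ _ (Cdominated_Im _ _ H)).
  change (Re (lattice_sum a)) with (box_lim (fun m n => Re (a m n))).
  change (Im (lattice_sum a)) with (box_lim (fun m n => Im (a m n))). lra.
Qed.

Lemma lattice_sum_lin (h : C) (K K' : R) (a c : Z -> Z -> C) :
  Cdominated K a -> Cdominated K' c ->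
  lattice_sum (fun m n => a m n + h * c m n)%C = (lattice_sum a + h * lattice_sum c)%C.
Proof.
  intros Ha Hc.
  pose proof (box_cv _ _ (Cdominated_Re _ _ Ha)) as L1.
  pose proof (box_cv _ _ (Cdominated_Im _ _ Ha)) as L2.
  pose proof (box_cv _ _ (Cdominated_Re _ _ Hc)) as L3.
  pose proof (box_cv _ _ (Cdominated_Im _ _ Hc)) as L4.
  pose proof (fun x => is_lim_seq_scal_l _ x _ L3) as S3.
  pose proof (fun x => is_lim_seq_scal_l _ x _ L4) as S4.
  cbn [Rbar_mult Rbar_mult'] in S3, S4.
  unfold lattice_sum at 1. unfold Cplus, Cmult, lattice_sum; cbn [fst snd]. f_equal.
  - apply box_lim_unique.
    eapply is_lim_seq_ext;
      [|apply (is_lim_seq_plus' _ _ _ _ L1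
          (is_lim_seq_minus' _ _ _ _ (S3 (fst h)) (S4 (snd h))))].
    intros N. cbn. rewrite <- !box_scal. unfold Rminus.
    rewrite <- (Rmult_1_l (- _)), Ropp_mult_distr_r_reverse, Ropp_mult_distr_l, <- box_scal, <- !box_plus.
    apply box_ext. intros m n. unfold Re, Im; cbn. ring.
  - apply box_lim_unique.
    eapply is_lim_seq_ext;
      [|apply (is_lim_seq_plus' _ _ _ _ L2
          (is_lim_seq_plus' _ _ _ _ (S4 (fst h)) (S3 (snd h))))].
    intros N. cbn. rewrite <- !box_scal, <- !box_plus.
    apply box_ext. intros m n. unfold Re, Im; cbn. ring.
Qed.

Lemma Cdominated_lin (h : C) (K K' : R) (a c : Z -> Z -> C) :
  Cdominated K a -> Cdominated K' c -> Cdominated (K + Cmod h * K') (fun m n => a m n + h * c m n)%C.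
Proof.
  intros Ha Hc m n. eapply Rle_trans; [apply Cmod_triangle|]. rewrite Cmod_mult.
  specialize (Ha m n). specialize (Hc m n). pose proof (Cmod_ge_0 h).
  pose proof (Rmult_le_compat_l _ _ _ H Hc). lra.
Qed.

Lemma RtoC_m1 : RtoC (-1) = (- RtoC 1)%C.
Proof. unfold RtoC, Copp; cbn. f_equal; ring. Qed.

(** Termwise differentiation: a quadratic error, dominated uniformly in the
    increment, survives summation. *)
Lemma lattice_sum_Cder (A B : C -> Z -> Z -> C) (z : C) (K delta : R) :
  0 < delta ->
  (forall h, Cmod h < delta -> Cdominated K (A (z + h)%C)) ->
  Cdominated K (B z) ->
  (forall h, Cmod h < delta -> Cdominated (K * Cmod h ^ 2)
     (fun m n => A (z + h)%C m n - A z m n - h * B z m n)%C) ->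
  Cder (fun z => lattice_sum (A z)) z (lattice_sum (B z)).
Proof.
  intros Hd HA HB HT.
  assert (HA0 : Cdominated K (A z)).
  { specialize (HA (RtoC 0)). rewrite Cmod_0, Cplus_0_r in HA. now apply HA. }
  assert (HK : 0 <= K) by (eapply dominated_ge0, Cdominated_Re, HB).
  apply Cder_intro. intros eps Heps.
  assert (HK1 : 0 < 50 * K + 1) by lra.
  exists (Rmin delta (eps / (50 * K + 1))). split.
  { apply Rmin_glb_lt; [lra|]. now apply Rdiv_lt_0_compat. }
  intros h Hh.
  assert (H1 : Cmod h < delta) by (eapply Rlt_le_trans; [apply Hh|apply Rmin_l]).
  assert (H2 : Cmod h < eps / (50 * K + 1))
    by (eapply Rlt_le_trans; [apply Hh|apply Rmin_r]).
  pose proof (lattice_sum_le _ _ (HT h H1)) as HL.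
  rewrite (lattice_sum_ext _ (fun m n => (A (z + h)%C m n + RtoC (-1) * A z m n)
                                 + (- h) * B z m n)%C) in HL.
  2:{ intros m n. rewrite RtoC_m1. ring. }
  rewrite (lattice_sum_lin (- h)%C _ _ _ _ (Cdominated_lin (RtoC (-1)) _ _ _ _ (HA h H1) HA0) HB) in HL.
  rewrite (lattice_sum_lin (RtoC (-1)) _ _ _ _ (HA h H1) HA0) in HL.
  replace (lattice_sum (A (z + h)%C) - lattice_sum (A z) - h * lattice_sum (B z))%C with
    (lattice_sum (A (z + h)%C) + RtoC (-1) * lattice_sum (A z) + - h * lattice_sum (B z))%C
    by (rewrite RtoC_m1; ring).
  eapply Rle_trans; [apply HL|]. pose proof (Cmod_ge_0 h) as H0.
  replace (50 * (K * Cmod h ^ 2)) with (50 * K * Cmod h * Cmod h) by ring.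
  apply Rmult_le_compat_r; [lra|].
  apply (Rmult_lt_compat_r _ _ _ HK1) in H2.
  unfold Rdiv in H2. rewrite Rmult_assoc, Rinv_l in H2 by lra. lra.
Qed.

(** * Distances to the lattice *)

Section Lattice.
Variables (a b : R).
Hypotheses (Ha : 0 < a) (Hb : 0 < b).

Definition lat (m n : Z) : C := (2 * IZR m * a, 2 * IZR n * b).

Lemma lattice_point_lat m n : lattice_point (RtoC a) (0, b) m n = lat m n.
Proof.
  unfold lattice_point, lat, RtoC, Cplus, Cmult; cbn. f_equal; ring.
Qed.

(** Comparable to the modulus of the lattice point, and never zero. *)
Definition size (m n : Z) : R := 1 + absZ m + absZ n.

Lemma size_ge1 m n : 1 <= size m n.
Proof. unfold size. pose proof (absZ_ge0 m). pose proof (absZ_ge0 n). lra. Qed.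

(** With [p^2 = 1 + |m|], [q^2 = 1 + |n|] and [s] the size,
    [2 p q <= p^2 + q^2 = s + 1 <= 2 s], whence [p^3 q^3 <= s^3]. *)
Lemma cube_weight x m n C0 :
  0 <= x -> x * size m n <= C0 -> x * x * x <= C0 * C0 * C0 * (weight m * weight n).
Proof.
  intros Hx HxC. pose proof (size_ge1 m n) as H1.
  pose proof (absZ_ge0 m) as Hm. pose proof (absZ_ge0 n) as Hn.
  set (s := size m n) in *.
  set (p := sqrt (1 + absZ m)). set (q := sqrt (1 + absZ n)).
  assert (Hp : p * p = 1 + absZ m) by (apply sqrt_sqrt; lra).
  assert (Hq : q * q = 1 + absZ n) by (apply sqrt_sqrt; lra).
  assert (Hp0 : 0 < p) by (apply sqrt_lt_R0; lra).
  assert (Hq0 : 0 < q) by (apply sqrt_lt_R0; lra).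
  assert (Hpq : (p * p * p) * (q * q * q) <= s * s * s).
  { assert (p * q <= s) by (unfold s, size in *; nra).
    assert (p * p <= s /\ q * q <= s) as [? ?] by (unfold s, size; lra).
    assert (p * p * (q * q) <= s * s) by (apply Rmult_le_compat; nra).
    replace (p * p * p * (q * q * q)) with (p * p * (q * q) * (p * q)) by ring.
    apply Rmult_le_compat; try nra. }
  assert (HC : x * s * (x * s) * (x * s) <= C0 * C0 * C0).
  { assert (0 <= x * s) by nra.
    assert (x * s * (x * s) <= C0 * C0) by nra. nra. }
  unfold weight. fold p q. rewrite <- Hp, <- Hq.
  assert (Hpos : 0 < p * p * p * (q * q * q)) by (repeat apply Rmult_lt_0_compat; lra).
  replace (/ (p * p * p) * / (q * q * q)) with (/ (p * p * p * (q * q * q)))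
    by (field; lra).
  apply Rmult_le_reg_r with (p * p * p * (q * q * q)); [lra|].
  rewrite (Rmult_assoc (C0 * C0 * C0)), Rinv_l, Rmult_1_r by lra.
  eapply Rle_trans; [|apply HC].
  replace (x * s * (x * s) * (x * s)) with (x * x * x * (s * s * s)) by ring.
  apply Rmult_le_compat_l; [|lra]. repeat apply Rmult_le_pos; lra.
Qed.

Definition recip (z : C) (m n : Z) : C := (/ (z - lat m n))%C.

Definition recip_lat (m n : Z) : C := (/ lat m n)%C.

(** Inversion sends [0] to [0], so the term at the origin, which carries no
    regularising constant, needs no case distinction. *)
Lemma recip_lat_00 : recip_lat 0 0 = RtoC 0.
Proof. unfold recip_lat, lat, Cinv, RtoC; cbn. f_equal; unfold Rdiv; ring. Qed.

Lemma lat_big m n :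
  2 * a * absZ m <= Cmod (lat m n) /\ 2 * b * absZ n <= Cmod (lat m n).
Proof.
  split.
  - eapply Rle_trans; [|apply re_le_Cmod].
    unfold Re, lat; cbn. rewrite !Rabs_mult, (Rabs_pos_eq a), (Rabs_pos_eq 2) by lra.
    unfold absZ. lra.
  - eapply Rle_trans; [|apply im_le_Cmod].
    unfold Im, lat; cbn. rewrite !Rabs_mult, (Rabs_pos_eq b), (Rabs_pos_eq 2) by lra.
    unfold absZ. lra.
Qed.

Lemma absZ_ge1 m : m <> 0%Z -> 1 <= absZ m.
Proof.
  intros H. unfold absZ. rewrite <- abs_IZR. apply IZR_le. lia.
Qed.

Lemma absZ_sum_ge1 m n : (m, n) <> (0, 0)%Z -> 1 <= absZ m + absZ n.
Proof.
  intros H. pose proof (absZ_ge0 m). pose proof (absZ_ge0 n).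
  destruct (Z.eq_dec m 0) as [->|Hm].
  - destruct (Z.eq_dec n 0) as [->|Hn]; [congruence|].
    apply absZ_ge1 in Hn. lra.
  - apply absZ_ge1 in Hm. lra.
Qed.

Definition inv_lat_const : R := / a + / b.

Lemma inv_lat_const_pos : 0 < inv_lat_const.
Proof. unfold inv_lat_const. pose proof (Rinv_0_lt_compat a Ha). pose proof (Rinv_0_lt_compat b Hb). lra. Qed.

Lemma size_lat m n : (m, n) <> (0, 0)%Z -> size m n <= inv_lat_const * Cmod (lat m n).
Proof.
  intros H. apply absZ_sum_ge1 in H. destruct (lat_big m n) as [L1 L2].
  apply (Rmult_le_compat_l (/ a)) in L1; [|apply Rlt_le, Rinv_0_lt_compat; lra].
  apply (Rmult_le_compat_l (/ b)) in L2; [|apply Rlt_le, Rinv_0_lt_compat; lra].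
  replace (/ a * (2 * a * absZ m)) with (2 * absZ m) in L1 by (field; lra).
  replace (/ b * (2 * b * absZ n)) with (2 * absZ n) in L2 by (field; lra).
  unfold size, inv_lat_const. lra.
Qed.

Lemma lat_neq0 m n : (m, n) <> (0, 0)%Z -> lat m n <> RtoC 0.
Proof.
  intros H E. apply size_lat in H. rewrite E, Cmod_0 in H.
  pose proof (size_ge1 m n). lra.
Qed.

Lemma inv_size (w : C) m n C0 :
  0 < C0 -> size m n <= C0 * Cmod w -> w <> RtoC 0 /\ Cmod (/ w)%C * size m n <= C0.
Proof.
  intros H0 H. pose proof (size_ge1 m n) as H1.
  assert (Hw : 0 < Cmod w) by nra.
  assert (Hw0 : w <> RtoC 0) by (now apply Cmod_gt_0). split; auto.
  rewrite Cmod_inv by auto.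
  apply Rmult_le_reg_l with (Cmod w); auto.
  rewrite <- Rmult_assoc, Rinv_r by lra. lra.
Qed.

Lemma recip_lat_size m n : Cmod (recip_lat m n) * size m n <= inv_lat_const.
Proof.
  assert (D : (m, n) = (0, 0)%Z \/ (m, n) <> (0, 0)%Z).
  { destruct (Z.eq_dec m 0) as [->|]; destruct (Z.eq_dec n 0) as [->|]; auto; right; congruence. }
  pose proof inv_lat_const_pos.
  destruct D as [E|E].
  - injection E as -> ->. rewrite recip_lat_00, Cmod_0. lra.
  - apply size_lat in E. apply inv_size; auto.
Qed.

(** It contains the line through [i b], and the rays from the origin to its points
    stay inside it. *)
Definition strip (z : C) : Prop := 0 < Im z < 2 * b.

Lemma strip_odd (y : R) (n : Z) d : d <= y <= 2 * b - d -> d <= Rabs (y - 2 * IZR n * b).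
Proof.
  intros H. destruct (Z_le_gt_dec n 0) as [L|L].
  - apply IZR_le in L. assert (IZR n * b <= 0) by nra.
    eapply Rle_trans; [|apply Rle_abs]. lra.
  - assert (1 <= n)%Z as L' by lia. apply IZR_le in L'. assert (b <= IZR n * b) by nra.
    rewrite <- Rabs_Ropp. eapply Rle_trans; [|apply Rle_abs]. lra.
Qed.

(** Points of the strip keep a positive distance [d] from the lattice, and for
    large indices the distance grows like the size; the constant is uniform on a
    neighbourhood, as termwise differentiation requires. *)
Lemma recip_bound (z : C) : strip z -> exists C0 delta : R, 1 <= C0 /\ 0 < delta /\
  forall h, Cmod h < delta -> strip (z + h)%C /\
   forall m n, (z + h - lat m n)%C <> RtoC 0 /\ Cmod (recip (z + h)%C m n) * size m n <= C0.
Proof.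
  intros Hz. unfold strip in Hz.
  set (d := Rmin (Im z) (2 * b - Im z) / 2).
  assert (Hd : 0 < d).
  { apply Rdiv_lt_0_compat; [|lra]. apply Rmin_glb_lt; lra. }
  assert (Hd1 : 2 * d <= Im z) by (unfold d; pose proof (Rmin_l (Im z) (2 * b - Im z)); lra).
  assert (Hd2 : 2 * d <= 2 * b - Im z) by (unfold d; pose proof (Rmin_r (Im z) (2 * b - Im z)); lra).
  set (X := Rabs (Re z) + d).
  set (C0 := / d * (2 + X * / a) + inv_lat_const + 1).
  assert (Hda : 0 < / a) by (apply Rinv_0_lt_compat; lra).
  assert (Hdb : 0 < / b) by (apply Rinv_0_lt_compat; lra).
  assert (Hdd : 0 < / d) by (apply Rinv_0_lt_compat; lra).
  assert (HX : 0 < X) by (unfold X; pose proof (Rabs_pos (Re z)); lra).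
  assert (HXa : 0 < X * / a) by (now apply Rmult_lt_0_compat).
  pose proof inv_lat_const_pos.
  assert (Hdx : 0 < / d * (2 + X * / a)) by (apply Rmult_lt_0_compat; lra).
  assert (HC0 : 1 <= C0) by (unfold C0; lra).
  exists C0, d. split; [auto|]. split; [auto|].
  intros h Hh.
  pose proof (re_le_Cmod h) as Hr. pose proof (im_le_Cmod h) as Hi.
  assert (Ei : Im (z + h)%C = Im z + Im h) by reflexivity.
  assert (Er : Re (z + h)%C = Re z + Re h) by reflexivity.
  assert (Hi' : - d <= Im h <= d) by (apply Rabs_le_between; lra).
  split; [unfold strip; rewrite Ei; lra|].
  intros m n. apply inv_size; [lra|].
  set (w := (z + h - lat m n)%C).
  assert (W1 : d <= Cmod w).
  { eapply Rle_trans; [|apply im_le_Cmod].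
    replace (Im w) with (Im (z + h)%C - 2 * IZR n * b) by (unfold w, lat, Im; cbn; ring).
    apply strip_odd. rewrite Ei. lra. }
  assert (W2 : 2 * a * absZ m - X <= Cmod w).
  { eapply Rle_trans; [|apply re_le_Cmod].
    replace (Re w) with (- (2 * a * IZR m - Re (z + h)%C)) by (unfold w, lat, Re; cbn; ring).
    rewrite Rabs_Ropp. eapply Rle_trans; [|apply Rabs_triang_inv].
    rewrite !Rabs_mult, (Rabs_pos_eq a), (Rabs_pos_eq 2) by lra. fold (absZ m).
    assert (Rabs (Re (z + h)%C) <= X); [|lra].
    rewrite Er. unfold X. eapply Rle_trans; [apply Rabs_triang|]. lra. }
  assert (W3 : 2 * b * absZ n - 2 * b <= Cmod w).
  { eapply Rle_trans; [|apply im_le_Cmod].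
    replace (Im w) with (- (2 * b * IZR n - Im (z + h)%C)) by (unfold w, lat, Im; cbn; ring).
    rewrite Rabs_Ropp. eapply Rle_trans; [|apply Rabs_triang_inv].
    rewrite !Rabs_mult, (Rabs_pos_eq b), (Rabs_pos_eq 2) by lra. fold (absZ n).
    rewrite Ei. rewrite (Rabs_pos_eq (Im z + Im h)) by lra. lra. }
  apply (Rmult_le_compat_l (/ d)) in W1; [|lra]. rewrite Rinv_l in W1 by lra.
  apply (Rmult_le_compat_l (/ a)) in W2; [|lra].
  apply (Rmult_le_compat_l (/ b)) in W3; [|lra].
  replace (/ a * (2 * a * absZ m - X)) with (2 * absZ m - X * / a) in W2 by (field; lra).
  replace (/ b * (2 * b * absZ n - 2 * b)) with (2 * absZ n - 2) in W3 by (field; lra).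
  assert (W4 : 2 + X * / a <= (2 + X * / a) * (/ d * Cmod w)).
  { rewrite <- (Rmult_1_r (2 + X * / a)) at 1. apply Rmult_le_compat_l; lra. }
  pose proof (absZ_ge0 m). pose proof (absZ_ge0 n).
  assert (0 <= Cmod w) by apply Cmod_ge_0.
  assert (0 <= / a * Cmod w) by (apply Rmult_le_pos; lra).
  assert (0 <= / b * Cmod w) by (apply Rmult_le_pos; lra).
  unfold size, C0, inv_lat_const.
  replace ((/ d * (2 + X * / a) + (/ a + / b) + 1) * Cmod w)
    with ((2 + X * / a) * (/ d * Cmod w) + (/ a * Cmod w + / b * Cmod w) + Cmod w) by ring.
  lra.
Qed.

End Lattice.

(** * Termwise derivatives of the Weierstrass series *)

Lemma Cmod_mult_le (x y : C) X Y :
  Cmod x <= X -> Cmod y <= Y -> Cmod (x * y)%C <= X * Y.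
Proof.
  intros. rewrite Cmod_mult. apply Rmult_le_compat; auto using Cmod_ge_0.
Qed.

Lemma Cmod_plus_le (x y : C) X Y :
  Cmod x <= X -> Cmod y <= Y -> Cmod (x + y)%C <= X + Y.
Proof. intros. eapply Rle_trans; [apply Cmod_triangle|]. lra. Qed.

Lemma Cmod_opp_le (x : C) X : Cmod x <= X -> Cmod (- x)%C <= X.
Proof. now rewrite Cmod_opp. Qed.

Lemma Cmod_const (c : R) : 0 <= c -> Cmod (RtoC c) <= c.
Proof. intros. rewrite Cmod_R, Rabs_pos_eq; lra. Qed.

Ltac cbound := repeat first
  [ eassumption | apply Cmod_const; lra
  | apply Cmod_mult_le | apply Cmod_plus_le | apply Cmod_opp_le | apply Rle_refl ].

Section Series.
Variables (a b : R).
Hypotheses (Ha : 0 < a) (Hb : 0 < b).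

(** [term1], [term2] and [term3] are the successive derivatives of [term0]. *)
Definition term0 (z : C) m n : C :=
  (recip a b z m n * recip a b z m n - recip_lat a b m n * recip_lat a b m n)%C.
Definition term1 (z : C) m n : C :=
  (- (RtoC 2 * (recip a b z m n * recip a b z m n * recip a b z m n)))%C.
Definition term2 (z : C) m n : C :=
  (RtoC 6 * (recip a b z m n * recip a b z m n * recip a b z m n * recip a b z m n))%C.
Definition term3 (z : C) m n : C :=
  (- (RtoC 24 * (recip a b z m n * recip a b z m n * recip a b z m n * recip a b z m n * recip a b z m n)))%C.

Lemma Cinv_mult_self (w : C) : (/ (w * w) = / w * / w)%C.
Proof.
  destruct (Ceq_dec w (RtoC 0)) as [->|H].
  - replace (RtoC 0 * RtoC 0)%C with (RtoC 0) by ring.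
    unfold Cinv, RtoC, Cmult; cbn. f_equal; unfold Rdiv; ring.
  - field. auto.
Qed.

Lemma wp_term_term0 z m n : wp_term (RtoC a) (0, b) z m n = term0 z m n.
Proof.
  unfold wp_term, term0, recip, recip_lat. rewrite lattice_point_lat.
  destruct (Z.eqb_spec m 0) as [->|Hm]; [destruct (Z.eqb_spec n 0) as [->|Hn]|]; cbn [andb].
  - assert (E : lat a b 0 0 = RtoC 0) by (unfold lat, RtoC; f_equal; ring).
    rewrite E.
    assert (E0 : (/ RtoC 0 = RtoC 0)%C)
      by (unfold Cinv, RtoC; cbn; f_equal; unfold Rdiv; ring).
    rewrite E0, Cinv_mult_self. replace (z - RtoC 0)%C with z by ring. ring.
  - now rewrite !Cinv_mult_self.
  - now rewrite !Cinv_mult_self.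
Qed.

Lemma wp_lattice_sum z : wp (RtoC a) (0, b) z = lattice_sum (term0 z).
Proof.
  unfold wp, lattice_sum, box_lim.
  assert (ER : forall (u : nat -> C) N, Re (sum_n u N) = sum_n (fun i => Re (u i)) N).
  { intros u N. induction N; [now rewrite !sum_O|]. rewrite !sum_Sn, <- IHN. reflexivity. }
  assert (EI : forall (u : nat -> C) N, Im (sum_n u N) = sum_n (fun i => Im (u i)) N).
  { intros u N. induction N; [now rewrite !sum_O|]. rewrite !sum_Sn, <- IHN. reflexivity. }
  f_equal; f_equal; apply Lim_seq_ext; intros N; unfold wp_partial.
  - rewrite ER. unfold box. rewrite <- sum_n_sumZ. apply sum_n_ext; intros i.
    rewrite ER, <- sum_n_sumZ. apply sum_n_ext; intros j. now rewrite wp_term_term0.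
  - rewrite EI. unfold box. rewrite <- sum_n_sumZ. apply sum_n_ext; intros i.
    rewrite EI, <- sum_n_sumZ. apply sum_n_ext; intros j. now rewrite wp_term_term0.
Qed.

Lemma pair_00_dec (m n : Z) : (m, n) = (0, 0)%Z \/ (m, n) <> (0, 0)%Z.
Proof.
  destruct (Z.eq_dec m 0) as [->|]; destruct (Z.eq_dec n 0) as [->|]; auto; right; congruence.
Qed.

(** With [u = 1/(z - l)] and [w = 1/l], the identity [u - (- w) = z u w] turns
    [u^2 - w^2] into a term of third order in the size. *)
Lemma term0_regularised z m n : (m, n) <> (0, 0)%Z -> (z - lat a b m n)%C <> RtoC 0 ->
  term0 z m n = (z * recip a b z m n * recip_lat a b m n * (recip a b z m n + - recip_lat a b m n))%C.
Proof.
  intros H H1. pose proof (lat_neq0 a b Ha Hb m n H). unfold term0, recip, recip_lat.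
  field. auto.
Qed.

Section Bound.
Variables (C0 : R) (m n : Z).
Hypothesis (HC0 : 1 <= C0).

Let x := C0 / size m n.

Lemma recip_le (w : C) : Cmod w * size m n <= C0 -> Cmod w <= x.
Proof.
  intros H. pose proof (size_ge1 m n). unfold x.
  apply Rmult_le_reg_r with (size m n); [lra|]. unfold Rdiv.
  rewrite Rmult_assoc, Rinv_l, Rmult_1_r by lra. auto.
Qed.

Lemma size_quot_range : 0 <= x <= C0.
Proof.
  pose proof (size_ge1 m n). unfold x. split.
  - apply Rlt_le, Rdiv_lt_0_compat; lra.
  - apply Rmult_le_reg_r with (size m n); [lra|]. unfold Rdiv.
    rewrite Rmult_assoc, Rinv_l, Rmult_1_r by lra. nra.
Qed.

Lemma size_quot_cube : x * x * x <= C0 * C0 * C0 * (weight m * weight n).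
Proof.
  pose proof (size_ge1 m n). apply cube_weight; [apply size_quot_range|].
  unfold x, Rdiv. rewrite Rmult_assoc, Rinv_l; lra.
Qed.

(** Terms of order [k + 3] in the reciprocals are dominated: three factors give the
    weight and the others are bounded. *)
Lemma poly_bound (w : C) (k : nat) (A : R) :
  0 <= A -> Cmod w <= A * (x * x * x) * x ^ k ->
  Cmod w <= A * C0 ^ (k + 3) * (weight m * weight n).
Proof.
  intros HA H. eapply Rle_trans; [apply H|]. pose proof size_quot_cube as X3.
  destruct size_quot_range as [X0 X1].
  clearbody x.
  assert (Xk : x ^ k <= C0 ^ k) by (apply pow_incr; auto).
  rewrite Rmult_assoc.
  replace (A * C0 ^ (k + 3) * (weight m * weight n))
    with (A * ((C0 * C0 * C0 * (weight m * weight n)) * C0 ^ k))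
    by (rewrite pow_add; ring).
  apply Rmult_le_compat_l; auto. apply Rmult_le_compat; auto.
  - repeat apply Rmult_le_pos; auto.
  - now apply pow_le.
Qed.
End Bound.

Lemma Cdominated_weaken K K' t : K <= K' -> Cdominated K t -> Cdominated K' t.
Proof.
  intros H D m n. eapply Rle_trans; [apply D|].
  pose proof (weight_gt0 m). pose proof (weight_gt0 n).
  apply Rmult_le_compat_r; [apply Rmult_le_pos; lra|auto].
Qed.

Lemma term0_bound z C0 : 1 <= C0 -> inv_lat_const a b <= C0 ->
  (forall m n, (z - lat a b m n)%C <> RtoC 0 /\ Cmod (recip a b z m n) * size m n <= C0) ->
  Cdominated ((2 * Cmod z + 1) * C0 ^ 3) (term0 z).
Proof.
  intros HC0 HC1 H m n. destruct (H m n) as [Hz Hu].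
  pose proof (Cmod_ge_0 z) as Hz0.
  apply (poly_bound C0 m n HC0 _ 0); [lra|].
  pose proof (size_quot_range C0 m n HC0) as [X0 X1].
  pose proof (recip_lat_size a b Ha Hb m n) as Hw.
  assert (Hw' : Cmod (recip_lat a b m n) * size m n <= C0) by lra.
  apply recip_le in Hu. apply recip_le in Hw'.
  rewrite pow_O, Rmult_1_r.
  destruct (pair_00_dec m n) as [E|E].
  - injection E as -> ->. unfold term0. rewrite recip_lat_00.
    replace (recip a b z 0 0 * recip a b z 0 0 - RtoC 0 * RtoC 0)%C
      with (recip a b z 0 0 * recip a b z 0 0)%C by ring.
    assert (E0 : C0 / size 0 0 = C0).
    { unfold size, absZ. rewrite Rabs_R0. field. }
    rewrite E0 in *. eapply Rle_trans; [cbound|].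
    assert (Q : C0 * C0 * 1 <= C0 * C0 * C0) by (apply Rmult_le_compat_l; nra).
    assert (0 <= C0 * C0 * C0) by nra.
    apply Rle_trans with (1 * (C0 * C0 * C0)); [lra|].
    apply Rmult_le_compat_r; lra.
  - rewrite term0_regularised by auto. eapply Rle_trans; [cbound|].
    set (x := C0 / size m n) in *. clearbody x.
    assert (0 <= x * x * x) by (repeat apply Rmult_le_pos; auto).
    replace (Cmod z * x * x * (x + x)) with (2 * Cmod z * (x * x * x)) by ring. lra.
Qed.

Lemma term123_bound z C0 : 1 <= C0 ->
  (forall m n, (z - lat a b m n)%C <> RtoC 0 /\ Cmod (recip a b z m n) * size m n <= C0) ->
  Cdominated (2 * C0 ^ 3) (term1 z) /\ Cdominated (6 * C0 ^ 4) (term2 z) /\ Cdominated (24 * C0 ^ 5) (term3 z).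
Proof.
  intros HC0 H. repeat split; intros m n; destruct (H m n) as [Hz Hu];
    apply recip_le in Hu.
  - apply (poly_bound C0 m n HC0 _ 0); [lra|].
    unfold term1. eapply Rle_trans; [cbound|]. right; ring.
  - apply (poly_bound C0 m n HC0 _ 1); [lra|].
    unfold term2. eapply Rle_trans; [cbound|]. right; ring.
  - apply (poly_bound C0 m n HC0 _ 2); [lra|].
    unfold term3. eapply Rle_trans; [cbound|]. right; ring.
Qed.

(** For [u = 1/(z - l)] and [v = 1/(z + h - l)] one has [v - u = - h u v]; in
    each remainder the factor [h^2] comes from using this identity twice. *)
Lemma term_taylor z h C0 : 1 <= C0 ->
  (forall m n, (z - lat a b m n)%C <> RtoC 0 /\ Cmod (recip a b z m n) * size m n <= C0) ->
  (forall m n, (z + h - lat a b m n)%C <> RtoC 0 /\ Cmod (recip a b (z + h)%C m n) * size m n <= C0) ->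
  Cdominated (3 * Cmod h ^ 2 * C0 ^ 4) (fun m n => term0 (z + h) m n - term0 z m n - h * term1 z m n)%C /\
  Cdominated (12 * Cmod h ^ 2 * C0 ^ 5) (fun m n => term1 (z + h) m n - term1 z m n - h * term2 z m n)%C /\
  Cdominated (60 * Cmod h ^ 2 * C0 ^ 6) (fun m n => term2 (z + h) m n - term2 z m n - h * term3 z m n)%C.
Proof.
  intros HC0 H H'.
  pose proof (Cmod_ge_0 h) as Hh. pose proof (pow_le _ 2 Hh) as Hh2.
  repeat split; intros m n; destruct (H m n) as [Hz Hu]; destruct (H' m n) as [Hz' Hv];
    apply recip_le in Hu; apply recip_le in Hv;
    set (u := recip a b z m n) in *; set (v := recip a b (z + h)%C m n) in *.
  - apply (poly_bound C0 m n HC0 _ 1); [lra|].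
    replace (term0 (z + h) m n - term0 z m n - h * term1 z m n)%C
      with (h * h * (u * u) * v * (v + RtoC 2 * u))%C
      by (unfold term0, term1, u, v, recip; field; auto).
    eapply Rle_trans; [cbound|]. right; ring.
  - apply (poly_bound C0 m n HC0 _ 2); [lra|].
    replace (term1 (z + h) m n - term1 z m n - h * term2 z m n)%C
      with (- (RtoC 2 * (h * h * (u * u) * v * (v * v + RtoC 2 * (u * v) + RtoC 3 * (u * u)))))%C
      by (unfold term1, term2, u, v, recip; field; auto).
    eapply Rle_trans; [cbound|]. right; ring.
  - apply (poly_bound C0 m n HC0 _ 3); [lra|].
    replace (term2 (z + h) m n - term2 z m n - h * term3 z m n)%C
      with (RtoC 6 * (h * h * (u * u) * v * (v * v * v + RtoC 2 * (u * (v * v))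
         + RtoC 3 * (u * u * v) + RtoC 4 * (u * u * u))))%C
      by (unfold term2, term3, u, v, recip; field; auto).
    eapply Rle_trans; [cbound|]. right; ring.
Qed.

Lemma quad_le k H Y K : 0 <= H -> k * Y <= K -> k * H * Y <= K * H.
Proof.
  intros H0 H1. replace (k * H * Y) with (k * Y * H) by ring.
  now apply Rmult_le_compat_r.
Qed.

Lemma series_Cder z : strip b z ->
  Cder (fun z => lattice_sum (term0 z)) z (lattice_sum (term1 z)) /\
  Cder (fun z => lattice_sum (term1 z)) z (lattice_sum (term2 z)) /\
  Cder (fun z => lattice_sum (term2 z)) z (lattice_sum (term3 z)).
Proof.
  intros Hz. destruct (recip_bound a b Ha Hb z Hz) as (C1 & delta & HC1 & Hd & Hh).
  set (C0 := C1 + inv_lat_const a b).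
  assert (HCl : 0 < inv_lat_const a b) by (apply inv_lat_const_pos; auto).
  assert (HC0 : 1 <= C0) by (unfold C0; lra).
  assert (G : forall h, Cmod h < delta -> forall m n, (z + h - lat a b m n)%C <> RtoC 0 /\
     Cmod (recip a b (z + h)%C m n) * size m n <= C0).
  { intros h H m n. destruct (Hh h H) as [_ H1]. destruct (H1 m n). split; auto.
    unfold C0; lra. }
  assert (G0 : forall m n, (z - lat a b m n)%C <> RtoC 0 /\ Cmod (recip a b z m n) * size m n <= C0).
  { specialize (G (RtoC 0)). rewrite Cmod_0, Cplus_0_r in G. now apply G. }
  pose proof (Cmod_ge_0 z) as Hz0.
  assert (P3 : 0 <= C0 ^ 3) by (apply pow_le; lra).
  pose proof (Rle_pow C0 3 6 HC0 ltac:(lia)).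
  pose proof (Rle_pow C0 4 6 HC0 ltac:(lia)).
  pose proof (Rle_pow C0 5 6 HC0 ltac:(lia)).
  set (K := (2 * (Cmod z + delta) + 100) * C0 ^ 6).
  assert (HK : 100 * C0 ^ 6 <= K) by (unfold K; apply Rmult_le_compat_r; lra).
  split; [|split].
  - apply (lattice_sum_Cder term0 term1 z K delta Hd).
    + intros h H2. eapply Cdominated_weaken; [|apply term0_bound; [exact HC0|unfold C0; lra|now apply G]].
      pose proof (Cmod_triangle z h). unfold K.
      apply Rmult_le_compat; auto; pose proof (Cmod_ge_0 (z + h)%C); lra.
    + eapply Cdominated_weaken; [|apply (term123_bound z C0 HC0 G0)]. lra.
    + intros h H2. eapply Cdominated_weaken; [|apply (term_taylor z h C0 HC0 G0 (G h H2))].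
      pose proof (pow_le _ 2 (Cmod_ge_0 h)).
      apply quad_le; lra.
  - apply (lattice_sum_Cder term1 term2 z K delta Hd).
    + intros h H2. eapply Cdominated_weaken; [|apply (term123_bound _ C0 HC0 (G h H2))]. lra.
    + eapply Cdominated_weaken; [|apply (term123_bound z C0 HC0 G0)]. lra.
    + intros h H2. eapply Cdominated_weaken; [|apply (term_taylor z h C0 HC0 G0 (G h H2))].
      pose proof (pow_le _ 2 (Cmod_ge_0 h)).
      apply quad_le; lra.
  - apply (lattice_sum_Cder term2 term3 z K delta Hd).
    + intros h H2. eapply Cdominated_weaken; [|apply (term123_bound _ C0 HC0 (G h H2))]. lra.
    + eapply Cdominated_weaken; [|apply (term123_bound z C0 HC0 G0)]. lra.
    + intros h H2. eapply Cdominated_weaken; [|apply (term_taylor z h C0 HC0 G0 (G h H2))].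
      pose proof (pow_le _ 2 (Cmod_ge_0 h)).
      apply quad_le; lra.
Qed.
End Series.

(** * Symmetries of the series *)

Lemma box_flip a N : box (fun m n => a (- m)%Z (- n)%Z) N = box a N.
Proof.
  unfold box. rewrite <- (sumZ_flip (fun m => sumZ (a m) N)).
  apply sumZ_ext; intros m. apply (sumZ_flip (a (- m)%Z)).
Qed.

Lemma box_flip_snd a N : box (fun m n => a m (- n)%Z) N = box a N.
Proof. unfold box. apply sumZ_ext; intros m. apply (sumZ_flip (a m)). Qed.

Lemma lattice_sum_flip a : lattice_sum (fun m n => a (- m)%Z (- n)%Z) = lattice_sum a.
Proof.
  unfold lattice_sum, box_lim. f_equal; f_equal; apply Lim_seq_ext; intros N.
  - apply (box_flip (fun m n => Re (a m n))).
  - apply (box_flip (fun m n => Im (a m n))).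
Qed.

Lemma lattice_sum_conj a : lattice_sum (fun m n => Cconj (a m (- n)%Z)) = Cconj (lattice_sum a).
Proof.
  unfold lattice_sum, Cconj, box_lim; cbn [fst snd]. f_equal.
  - f_equal. apply Lim_seq_ext; intros N. apply (box_flip_snd (fun m n => Re (a m n))).
  - rewrite <- Rbar_opp_real, <- Lim_seq_opp. f_equal. apply Lim_seq_ext; intros N.
    transitivity (-1 * box (fun m n => Im (a m (- n)%Z)) N).
    + rewrite <- box_scal. apply box_ext; intros m n. unfold Im, Cconj; cbn. ring.
    + rewrite (box_flip_snd (fun m n => Im (a m n))).
      change (box (fun m n => Im (a m n)) N) with (box (fun m n => snd (a m n)) N). ring.
Qed.

(** ** Shifting the index by one *)

(** Squares of reciprocals are not summable over Z^2, but they are along each side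
    of the square, with a sum that tends to zero with the distance of the side. *)
Definition slow (m n : Z) : R := weight n / sqrt (1 + absZ m).

Lemma sqrt_1_pos x : 0 <= x -> 0 < sqrt (1 + x).
Proof. intros. apply sqrt_lt_R0. lra. Qed.

Lemma lim_inv_sqrt : is_lim_seq (fun N => / sqrt (1 + INR N)) 0.
Proof.
  apply is_lim_seq_spec. intros eps.
  destruct (INR_unbounded (/ eps * / eps)) as [N0 HN].
  exists N0. intros N HNN.
  pose proof (sqrt_1_pos (INR N) (pos_INR N)) as Hs.
  rewrite Rminus_0_r, Rabs_pos_eq by (apply Rlt_le, Rinv_0_lt_compat; auto).
  assert (He : 0 < / eps) by (apply Rinv_0_lt_compat, cond_pos).
  rewrite <- (Rinv_inv eps). apply Rinv_lt_contravar; [apply Rmult_lt_0_compat; auto|].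
  rewrite <- (sqrt_square (/ eps)) by lra. apply sqrt_lt_1; [nra| |].
  - pose proof (pos_INR N). lra.
  - apply le_INR in HNN. lra.
Qed.

Lemma sumZ_slow M (f : Z -> R) (m : Z) (N : nat) : INR N <= absZ m -> 0 <= M ->
  (forall n, Rabs (f n) <= M * slow m n) ->
  Rabs (sumZ f N) <= 5 * M * / sqrt (1 + INR N).
Proof.
  intros Hm HM Hf. pose proof (pos_INR N) as HN0.
  pose proof (sqrt_1_pos _ HN0) as Hs.
  eapply Rle_trans; [apply sumZ_abs|].
  eapply Rle_trans; [apply (sumZ_le _ (fun n => (M / sqrt (1 + absZ m)) * weight n))|].
  { intros n. eapply Rle_trans; [apply Hf|]. unfold slow. right. unfold Rdiv. ring. }
  rewrite sumZ_scal. destruct (sumZ_weight_le N) as [B0 B5].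
  assert (Hi : / sqrt (1 + absZ m) <= / sqrt (1 + INR N)).
  { apply Rinv_le_contravar; auto. apply sqrt_le_1; lra. }
  assert (Hp : 0 < / sqrt (1 + absZ m)) by (apply Rinv_0_lt_compat, sqrt_1_pos; lra).
  unfold Rdiv. replace (5 * M * / sqrt (1 + INR N)) with (M * / sqrt (1 + INR N) * 5) by ring.
  apply Rmult_le_compat; auto.
  - apply Rmult_le_pos; lra.
  - apply Rmult_le_compat_l; auto.
Qed.

Lemma absZ_edge (N : nat) : INR N <= absZ (Z.of_nat N + 1) /\ INR N <= absZ (- Z.of_nat N).
Proof.
  rewrite absZ_opp, absZ_nat. split; [|lra].
  replace (Z.of_nat N + 1)%Z with (Z.of_nat (S N)) by lia.
  rewrite absZ_nat, S_INR. lra.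
Qed.

Lemma edge_lim M (u : nat -> R) :
  (forall N, Rabs (u N) <= M * / sqrt (1 + INR N)) -> is_lim_seq u 0.
Proof.
  intros H. apply is_lim_seq_abs_0.
  apply (is_lim_seq_le_le (fun _ => 0) _ (fun N => M * / sqrt (1 + INR N))).
  - intros N. split; [apply Rabs_pos|apply H].
  - apply is_lim_seq_const.
  - replace (Finite 0) with (Rbar_mult M 0) by (cbn; f_equal; ring).
    apply is_lim_seq_scal_l, lim_inv_sqrt.
Qed.

(** Only two opposite sides of the square remain after telescoping. *)
Lemma box_shift_fst M g : 0 <= M -> (forall m n, Rabs (g m n) <= M * slow m n) ->
  is_lim_seq (box (fun m n => g (m + 1)%Z n - g m n)) 0.
Proof.
  intros HM Hg. apply (edge_lim (10 * M)). intros N. unfold box.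
  rewrite (sumZ_ext _ (fun m => sumZ (g (m + 1)%Z) N - sumZ (g m) N)).
  2:{ intros m. rewrite (sumZ_ext _ (fun n => g (m + 1)%Z n + -1 * g m n)) by (intros; ring).
      rewrite sumZ_plus, sumZ_scal. ring. }
  rewrite (sumZ_telescope (fun m => sumZ (g m) N)).
  destruct (absZ_edge N) as [E1 E2].
  pose proof (sumZ_slow M (g (Z.of_nat N + 1)%Z) _ N E1 HM (Hg _)).
  pose proof (sumZ_slow M (g (- Z.of_nat N)%Z) _ N E2 HM (Hg _)).
  eapply Rle_trans; [apply Rabs_triang|]. rewrite Rabs_Ropp. lra.
Qed.

Lemma box_shift_snd M g : 0 <= M -> (forall m n, Rabs (g m n) <= M * slow n m) ->
  is_lim_seq (box (fun m n => g m (n + 1)%Z - g m n)) 0.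
Proof.
  intros HM Hg. apply (edge_lim (10 * M)). intros N. unfold box.
  rewrite (sumZ_ext _ (fun m => g m (Z.of_nat N + 1)%Z + -1 * g m (- Z.of_nat N)%Z)).
  2:{ intros m. rewrite (sumZ_telescope (g m)). ring. }
  rewrite sumZ_plus, sumZ_scal.
  destruct (absZ_edge N) as [E1 E2].
  pose proof (sumZ_slow M (fun m => g m (Z.of_nat N + 1)%Z) _ N E1 HM (fun m => Hg m _)).
  pose proof (sumZ_slow M (fun m => g m (- Z.of_nat N)%Z) _ N E2 HM (fun m => Hg m _)).
  eapply Rle_trans; [apply Rabs_triang|].
  rewrite Rabs_mult, (Rabs_left (-1)) by lra. lra.
Qed.

Lemma box_lim_plus_null K a e : dominated K a -> is_lim_seq (box e) 0 ->
  box_lim (fun m n => a m n + e m n) = box_lim a.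
Proof.
  intros Ha He. apply box_lim_unique.
  pose proof (is_lim_seq_plus' _ _ _ _ (box_cv _ _ Ha) He) as L.
  rewrite Rplus_0_r in L. eapply is_lim_seq_ext; [|apply L].
  intros N. cbn. now rewrite box_plus.
Qed.

Lemma sq_slow x m n C0 : 0 <= x -> x * size m n <= C0 ->
  x * x <= C0 * C0 * slow m n /\ x * x <= C0 * C0 * slow n m.
Proof.
  assert (G : forall m n s, s = size m n -> 0 <= x -> x * s <= C0 -> x * x <= C0 * C0 * slow m n).
  { clear m n. intros m n s Es Hx HxC. pose proof (size_ge1 m n) as H1.
    pose proof (absZ_ge0 m) as Hm. pose proof (absZ_ge0 n) as Hn.
    unfold slow, weight.
    set (p := sqrt (1 + absZ m)). set (q := sqrt (1 + absZ n)).
    assert (Hp : p * p = 1 + absZ m) by (apply sqrt_sqrt; lra).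
    assert (Hq : q * q = 1 + absZ n) by (apply sqrt_sqrt; lra).
    assert (Hp0 : 0 < p) by (apply sqrt_1_pos; lra).
    assert (Hq0 : 0 < q) by (apply sqrt_1_pos; lra).
    assert (Hpq : p * (q * q * q) <= s * s).
    { assert (p * q <= s) by (rewrite Es; unfold size; nra).
      assert (q * q <= s) by (rewrite Es; unfold size; lra).
      replace (p * (q * q * q)) with ((p * q) * (q * q)) by ring.
      apply Rmult_le_compat; nra. }
    assert (HC : x * s * (x * s) <= C0 * C0) by (assert (0 <= x * s) by nra; nra).
    assert (Hpos : 0 < p * (q * q * q)) by (repeat apply Rmult_lt_0_compat; lra).
    rewrite <- Hq.
    replace (/ (q * q * q) / p) with (/ (p * (q * q * q))) by (field; lra).
    apply Rmult_le_reg_r with (p * (q * q * q)); [lra|].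
    rewrite (Rmult_assoc (C0 * C0)), Rinv_l, Rmult_1_r by lra.
    eapply Rle_trans; [|apply HC].
    replace (x * s * (x * s)) with (x * x * (s * s)) by ring.
    apply Rmult_le_compat_l; [nra|lra]. }
  intros Hx HxC. split.
  - eapply G; eauto.
  - apply (G n m (size m n)); auto. unfold size; ring.
Qed.

Section Symmetry.
Variables (a b : R).
Hypotheses (Ha : 0 < a) (Hb : 0 < b).

Lemma Cinv_opp_total (w : C) : (/ (- w) = - / w)%C.
Proof.
  unfold Cinv, Copp; cbn. unfold Rdiv.
  replace (- fst w * (- fst w * 1) + - snd w * (- snd w * 1))
    with (fst w * (fst w * 1) + snd w * (snd w * 1)) by ring.
  f_equal; ring.
Qed.

Lemma Cinv_conj_total (w : C) : (/ Cconj w = Cconj (/ w))%C.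
Proof.
  unfold Cinv, Cconj; cbn. unfold Rdiv.
  replace (- snd w * (- snd w * 1)) with (snd w * (snd w * 1)) by ring.
  f_equal; ring.
Qed.

Lemma series_even z : lattice_sum (term0 a b (- z)) = lattice_sum (term0 a b z).
Proof.
  rewrite <- (lattice_sum_flip (term0 a b z)). apply lattice_sum_ext; intros m n.
  unfold term0, recip, recip_lat.
  replace (- z - lat a b m n)%C with (- (z - lat a b (- m) (- n)))%C
    by (unfold lat, Cminus, Cplus, Copp; cbn; rewrite !opp_IZR; f_equal; ring).
  replace (lat a b m n) with (- lat a b (- m) (- n))%C
    by (unfold lat, Copp; cbn; rewrite !opp_IZR; f_equal; ring).
  rewrite !Cinv_opp_total. ring.
Qed.

Lemma series_conj z : lattice_sum (term0 a b (Cconj z)) = Cconj (lattice_sum (term0 a b z)).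
Proof.
  rewrite <- lattice_sum_conj. apply lattice_sum_ext; intros m n.
  unfold term0, recip, recip_lat.
  replace (Cconj z - lat a b m n)%C with (Cconj (z - lat a b m (- n)))
    by (unfold lat, Cconj, Cminus, Cplus, Copp; cbn; rewrite !opp_IZR; f_equal; ring).
  replace (lat a b m n) with (Cconj (lat a b m (- n)))
    by (unfold lat, Cconj; cbn; rewrite !opp_IZR; f_equal; ring).
  rewrite !Cinv_conj_total.
  set (u := (/ (z - lat a b m (- n)))%C). set (w := (/ lat a b m (- n))%C).
  unfold Cconj, Cminus, Cplus, Cmult, Copp; cbn. f_equal; ring.
Qed.

Lemma strip_term0_dominated z : strip b z -> exists K C0, 0 <= C0 /\ Cdominated K (term0 a b z) /\
  forall m n, Cmod (recip a b z m n) * size m n <= C0.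
Proof.
  intros Hz. destruct (recip_bound a b Ha Hb z Hz) as (C1 & delta & HC1 & Hd & Hh).
  destruct (Hh (RtoC 0)) as [_ H0]; [now rewrite Cmod_0|]. rewrite Cplus_0_r in H0.
  pose proof (inv_lat_const_pos a b Ha Hb).
  exists ((2 * Cmod z + 1) * (C1 + inv_lat_const a b) ^ 3), C1. split; [lra|]. split.
  - apply term0_bound; auto; try lra. intros m n. destruct (H0 m n). split; auto. lra.
  - intros m n. apply H0.
Qed.

Definition recip_square (z : C) m n : C := (recip a b z m n * recip a b z m n)%C.

Lemma recip_square_slow z C0 m n : Cmod (recip a b z m n) * size m n <= C0 ->
  Cmod (recip_square z m n) <= C0 * C0 * slow m n /\ Cmod (recip_square z m n) <= C0 * C0 * slow n m.
Proof.
  intros H. unfold recip_square. rewrite Cmod_mult. apply sq_slow; auto. apply Cmod_ge_0.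
Qed.

(** Stated for a perturbation whose box sums tend to zero, as the squares of the
    reciprocals are not dominated. *)
Lemma series_null_perturbation z (e : Z -> Z -> C) K (T' : Z -> Z -> C) :
  Cdominated K (term0 a b z) ->
  (forall m n, T' m n = term0 a b z m n + e m n)%C ->
  is_lim_seq (box (fun m n => Re (e m n))) 0 ->
  is_lim_seq (box (fun m n => Im (e m n))) 0 ->
  lattice_sum T' = lattice_sum (term0 a b z).
Proof.
  intros HK HT HR HI. rewrite (lattice_sum_ext _ _ HT). unfold lattice_sum. f_equal.
  - apply (box_lim_plus_null K (fun m n => Re (term0 a b z m n)) (fun m n => Re (e m n)));
      auto. now apply Cdominated_Re.
  - apply (box_lim_plus_null K (fun m n => Im (term0 a b z m n)) (fun m n => Im (e m n)));
      auto. now apply Cdominated_Im.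
Qed.

Lemma series_period_fst z : strip b z -> lattice_sum (term0 a b (z - (2 * a, 0)%R)%C) = lattice_sum (term0 a b z).
Proof.
  intros Hz. destruct (strip_term0_dominated z Hz) as (K & C0 & HC0 & HK & HG).
  apply (series_null_perturbation z (fun m n => recip_square z (m + 1) n - recip_square z m n)%C K); auto.
  - intros m n. unfold term0, recip_square, recip.
    replace (z - (2 * a, 0)%R - lat a b m n)%C with (z - lat a b (m + 1) n)%C.
    + ring.
    + unfold lat, Cminus, Cplus, Copp; cbn. rewrite plus_IZR. f_equal; ring.
  - apply (box_shift_fst (C0 * C0) (fun m n => Re (recip_square z m n))); [nra|].
    intros m n. eapply Rle_trans; [apply re_le_Cmod|]. now apply recip_square_slow.
  - apply (box_shift_fst (C0 * C0) (fun m n => Im (recip_square z m n))); [nra|].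
    intros m n. eapply Rle_trans; [apply im_le_Cmod|]. now apply recip_square_slow.
Qed.

Lemma series_period_snd z : strip b z -> lattice_sum (term0 a b (z - (0, 2 * b)%R)%C) = lattice_sum (term0 a b z).
Proof.
  intros Hz. destruct (strip_term0_dominated z Hz) as (K & C0 & HC0 & HK & HG).
  apply (series_null_perturbation z (fun m n => recip_square z m (n + 1) - recip_square z m n)%C K); auto.
  - intros m n. unfold term0, recip_square, recip.
    replace (z - (0, 2 * b)%R - lat a b m n)%C with (z - lat a b m (n + 1))%C.
    + ring.
    + unfold lat, Cminus, Cplus, Copp; cbn. rewrite plus_IZR. f_equal; ring.
  - apply (box_shift_snd (C0 * C0) (fun m n => Re (recip_square z m n))); [nra|].
    intros m n. eapply Rle_trans; [apply re_le_Cmod|]. now apply recip_square_slow.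
  - apply (box_shift_snd (C0 * C0) (fun m n => Im (recip_square z m n))); [nra|].
    intros m n. eapply Rle_trans; [apply im_le_Cmod|]. now apply recip_square_slow.
Qed.

(** ** The pole at the origin *)

(** Away from the origin the lattice points are at distance at least [2 rho], so
    the terms other than [1/z^2] are dominated uniformly for [|z| < rho]. *)
Lemma series_pole : exists rho K, 0 < rho /\
  forall z, Cmod z < rho -> Cmod (lattice_sum (term0 a b z) - / z * / z)%C <= K.
Proof.
  set (rho := Rmin a b).
  assert (Hra : rho <= a) by apply Rmin_l. assert (Hrb : rho <= b) by apply Rmin_r.
  assert (Hr : 0 < rho) by (apply Rmin_glb_lt; auto).
  pose proof (inv_lat_const_pos a b Ha Hb) as Hc.
  set (C0 := 2 * inv_lat_const a b + 1).
  exists rho, (50 * (2 * rho * C0 ^ 3)). split; auto. intros z Hz.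
  set (is0 := fun m n => andb (Z.eqb m 0) (Z.eqb n 0)).
  set (D := fun m n : Z => if is0 m n then (/ z * / z)%C else RtoC 0).
  set (Rm := fun m n : Z => if is0 m n then RtoC 0 else term0 a b z m n).
  assert (I0 : forall m n, is0 m n = false -> (m, n) <> (0, 0)%Z).
  { intros m n H E. injection E as -> ->. discriminate H. }
  assert (I1 : forall m n, is0 m n = true -> m = 0%Z /\ n = 0%Z).
  { intros m n H. apply andb_prop in H as [H1 H2].
    apply Z.eqb_eq in H1. apply Z.eqb_eq in H2. auto. }
  assert (HE : forall m n, term0 a b z m n = (Rm m n + RtoC 1 * D m n)%C).
  { intros m n. unfold Rm, D. destruct (is0 m n) eqn:E; [|ring].
    apply I1 in E as [-> ->]. unfold term0. rewrite recip_lat_00. unfold recip.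
    replace (z - lat a b 0 0)%C with z; [ring|].
    unfold lat, Cminus, Cplus, Copp; destruct z; cbn. f_equal; ring. }
  assert (HR : Cdominated (2 * rho * C0 ^ 3) Rm).
  { intros m n. unfold Rm. pose proof (weight_gt0 m). pose proof (weight_gt0 n).
    assert (0 <= C0 ^ 3) by (apply pow_le; unfold C0; lra).
    destruct (is0 m n) eqn:E.
    - rewrite Cmod_0. apply Rmult_le_pos; apply Rmult_le_pos; lra.
    - apply I0 in E. pose proof (absZ_sum_ge1 m n E) as E1.
      pose proof (size_lat a b Ha Hb m n E) as E2.
      destruct (lat_big a b Ha Hb m n) as [L1 L2].
      assert (L : 2 * rho <= Cmod (lat a b m n)).
      { destruct (Z.eq_dec m 0) as [->|Hm].
        - destruct (Z.eq_dec n 0) as [->|Hn]; [now destruct E|].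
          apply absZ_ge1, (Rmult_le_compat_l b) in Hn; lra.
        - apply absZ_ge1, (Rmult_le_compat_l a) in Hm; lra. }
      assert (W : Cmod (lat a b m n) <= 2 * Cmod (z - lat a b m n)%C).
      { pose proof (Cmod_triangle (z - lat a b m n)%C (- z)%C) as W.
        replace (z - lat a b m n + - z)%C with (- lat a b m n)%C in W by ring.
        rewrite !Cmod_opp in W. lra. }
      destruct (inv_size (z - lat a b m n)%C m n C0) as [W0 W1].
      { unfold C0; lra. }
      { eapply Rle_trans; [apply E2|].
        eapply Rle_trans; [apply Rmult_le_compat_l; [lra|apply W]|].
        pose proof (Cmod_ge_0 (z - lat a b m n)%C). unfold C0. nra. }
      assert (HC0 : 1 <= C0) by (unfold C0; lra).
      apply (poly_bound C0 m n HC0 _ 0); [lra|].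
      rewrite (term0_regularised a b Ha Hb z m n E W0).
      pose proof (recip_lat_size a b Ha Hb m n) as Hw.
      assert (Hw' : Cmod (recip_lat a b m n) * size m n <= C0) by (unfold C0; lra).
      fold (recip a b z m n) in W1.
      apply recip_le in W1. apply recip_le in Hw'. apply Rlt_le in Hz.
      eapply Rle_trans; [cbound|]. right; ring. }
  assert (HD : Cdominated (Cmod (/ z * / z)%C) D).
  { intros m n. unfold D. pose proof (weight_gt0 m). pose proof (weight_gt0 n).
    destruct (is0 m n) eqn:E.
    - apply I1 in E as [-> ->]. right. unfold weight, absZ.
      rewrite Rabs_R0, Rplus_0_r, sqrt_1. field.
    - rewrite Cmod_0. apply Rmult_le_pos; [apply Cmod_ge_0|]. apply Rmult_le_pos; lra. }
  rewrite (lattice_sum_ext _ _ HE), (lattice_sum_lin _ _ _ _ _ HR HD).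
  assert (HDL : lattice_sum D = (/ z * / z)%C).
  { assert (BD : forall (g : C -> R), g (RtoC 0) = 0 ->
      box_lim (fun m n => g (D m n)) = g (/ z * / z)%C).
    { intros g Hg. apply box_lim_unique.
      apply (is_lim_seq_ext (fun _ => g (/ z * / z)%C)); [|apply is_lim_seq_const].
      intros N. unfold box. rewrite sumZ_delta.
      - rewrite sumZ_delta; [reflexivity|]. intros n Hn. unfold D.
        destruct (is0 0%Z n) eqn:E; auto. apply I1 in E. tauto.
      - intros m Hm. rewrite sumZ_delta; intros; unfold D;
          (destruct (is0 m _) eqn:E; [apply I1 in E; tauto|auto]). }
    unfold lattice_sum. rewrite (BD Re eq_refl), (BD Im eq_refl).
    destruct (/ z * / z)%C; reflexivity. }
  rewrite HDL.
  replace (lattice_sum Rm + RtoC 1 * (/ z * / z) - / z * / z)%C with (lattice_sum Rm) by ring.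
  now apply lattice_sum_le.
Qed.
End Symmetry.

(** * Uniqueness for real differential equations *)

Lemma is_derive_shift (f : R -> R) (s t d : R) :
  is_derive f (t + s) d -> is_derive (fun t => f (t + s)) t d.
Proof.
  intros H. evar_last; [apply (is_derive_comp f (fun t => t + s) t d 1 H)|].
  - auto_derive; [exact I|ring].
  - unfold scal; cbn. unfold mult; cbn. ring.
Qed.

Lemma is_derive_reflect (f : R -> R) (s t d : R) :
  is_derive f (s - t) d -> is_derive (fun t => f (s - t)) t (- d).
Proof.
  intros H. evar_last; [apply (is_derive_comp f (fun t => s - t) t d (-1) H)|].
  - auto_derive; [exact I|ring].
  - unfold scal; cbn. unfold mult; cbn. ring.
Qed.

(** Gronwall for the energy: the system is [D'' = (al + i be) D] with
    [D = d1 + i d2], written in real coordinates. *)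
Lemma linear_ode_unique (d1 d2 d3 d4 al be : R -> R) (t0 t1 : R) :
  (forall s, Rmin t0 t1 <= s <= Rmax t0 t1 ->
     is_derive d1 s (d3 s) /\ is_derive d2 s (d4 s) /\
     is_derive d3 s (al s * d1 s - be s * d2 s) /\
     is_derive d4 s (be s * d1 s + al s * d2 s) /\
     continuous al s /\ continuous be s) ->
  d1 t0 = 0 -> d2 t0 = 0 -> d3 t0 = 0 -> d4 t0 = 0 ->
  d1 t1 = 0 /\ d2 t1 = 0 /\ d3 t1 = 0 /\ d4 t1 = 0.
Proof.
  intros H I1 I2 I3 I4.
  destruct (bounded_continuity al (Rmin t0 t1) (Rmax t0 t1)) as [K1 HK1].
  { intros s Hs. apply (H s Hs). }
  destruct (bounded_continuity be (Rmin t0 t1) (Rmax t0 t1)) as [K2 HK2].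
  { intros s Hs. apply (H s Hs). }
  set (K := Rmax K1 K2).
  set (E := fun s => d1 s * d1 s + d2 s * d2 s + d3 s * d3 s + d4 s * d4 s).
  set (dE := fun s => 2 * (d1 s * d3 s + d2 s * d4 s + d3 s * (al s * d1 s - be s * d2 s)
                           + d4 s * (be s * d1 s + al s * d2 s))).
  set (L := 1 + 2 * K).
  assert (HE : forall s, Rmin t0 t1 <= s <= Rmax t0 t1 -> Rabs (dE s) <= L * E s).
  { intros s Hs. specialize (HK1 s Hs). specialize (HK2 s Hs).
    change (Rabs (al s) < K1) in HK1. change (Rabs (be s) < K2) in HK2.
    assert (A1 : Rabs (al s) <= K) by (unfold K; pose proof (Rmax_l K1 K2); lra).
    assert (A2 : Rabs (be s) <= K) by (unfold K; pose proof (Rmax_r K1 K2); lra).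
    assert (B : forall k x y, Rabs k <= K -> Rabs (2 * (k * (x * y))) <= K * (x * x + y * y)).
    { intros k x y Hk. rewrite !Rabs_mult, (Rabs_pos_eq 2) by lra.
      pose proof (Rabs_pos k). pose proof (Rabs_pos x) as H1. pose proof (Rabs_pos y) as H2.
      assert (X : Rabs x * Rabs x = x * x) by (rewrite <- Rabs_mult; apply Rabs_pos_eq; nra).
      assert (Y : Rabs y * Rabs y = y * y) by (rewrite <- Rabs_mult; apply Rabs_pos_eq; nra).
      rewrite <- X, <- Y.
      replace (2 * (Rabs k * (Rabs x * Rabs y))) with (Rabs k * (2 * (Rabs x * Rabs y))) by ring.
      pose proof (Rmult_le_pos _ _ H1 H2).
      pose proof (Rle_0_sqr (Rabs x - Rabs y)) as Q. unfold Rsqr in Q.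
      apply Rmult_le_compat; lra. }
    pose proof (B (al s) (d3 s) (d1 s) A1) as B1. pose proof (B (be s) (d3 s) (d2 s) A2) as B2.
    pose proof (B (be s) (d4 s) (d1 s) A2) as B3. pose proof (B (al s) (d4 s) (d2 s) A1) as B4.
    apply Rabs_le_between in B1, B2, B3, B4. apply Rabs_le_between.
    unfold dE, L, E.
    assert (Q : forall x y, - (x * x + y * y) <= 2 * (x * y) <= x * x + y * y).
    { intros x y. pose proof (Rle_0_sqr (x - y)) as Q1. pose proof (Rle_0_sqr (x + y)) as Q2.
      unfold Rsqr in Q1, Q2. lra. }
    pose proof (Q (d1 s) (d3 s)). pose proof (Q (d2 s) (d4 s)).
    lra. }
  assert (ED : forall s, Rmin t0 t1 <= s <= Rmax t0 t1 -> is_derive E s (dE s)).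
  { intros s Hs. destruct (H s Hs) as (D1 & D2 & D3 & D4 & _).
    unfold E, dE. auto_derive.
    - repeat split; auto; eexists; eassumption.
    - replace (Derive (fun x => d1 x) s) with (d3 s) by (symmetry; now apply is_derive_unique).
      replace (Derive (fun x => d2 x) s) with (d4 s) by (symmetry; now apply is_derive_unique).
      replace (Derive (fun x => d3 x) s) with (al s * d1 s - be s * d2 s)
        by (symmetry; now apply is_derive_unique).
      replace (Derive (fun x => d4 x) s) with (be s * d1 s + al s * d2 s)
        by (symmetry; now apply is_derive_unique).
      ring. }
  assert (E0 : E t0 = 0) by (unfold E; rewrite I1, I2, I3, I4; ring).
  set (sg := if Rle_dec t0 t1 then -1 else 1).
  set (F := fun s => E s * exp (sg * L * s)).
  set (dF := fun s => (dE s + sg * L * E s) * exp (sg * L * s)).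
  assert (FD : forall s, Rmin t0 t1 <= s <= Rmax t0 t1 -> is_derive F s (dF s)).
  { intros s Hs. specialize (ED s Hs). unfold F, dF. auto_derive.
    - exists (dE s); exact ED.
    - replace (Derive (fun x => E x) s) with (dE s) by (symmetry; now apply is_derive_unique).
      ring. }
  destruct (MVT_gen F t0 t1 dF) as (c & Hc & EF).
  { intros s Hs. apply FD. lra. }
  { intros s Hs. apply derivable_continuous_pt.
    exists (dF s). apply is_derive_Reals. now apply FD. }
  assert (F1 : F t1 <= 0).
  { replace (F t0) with 0 in EF by (unfold F; rewrite E0; ring).
    specialize (HE c Hc). apply Rabs_le_between in HE.
    pose proof (exp_pos (sg * L * c)) as Hx.
    enough (dF c * (t1 - t0) <= 0) by lra.
    unfold dF, sg in *. destruct (Rle_dec t0 t1).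
    - assert ((dE c + -1 * L * E c) * exp (-1 * L * c) <= 0) by nra. nra.
    - assert (0 <= (dE c + 1 * L * E c) * exp (1 * L * c)) by nra. nra. }
  assert (E1 : E t1 <= 0).
  { unfold F in F1. pose proof (exp_pos (sg * L * t1)).
    destruct (Rle_lt_dec (E t1) 0); auto.
    pose proof (Rmult_lt_0_compat _ _ r H0). lra. }
  unfold E in E1. repeat split; nra.
Qed.

(** * The second-order equation *)

Section Equation.
Variables (a b g2 g3 : R).
Hypotheses (Ha : 0 < a) (Hb : 0 < b).
Hypothesis (HW : weierstrass_equation (RtoC a) (0, b) g2 g3).

Notation P := (fun z : C => lattice_sum (term0 a b z)).
Notation P1 := (fun z : C => lattice_sum (term1 a b z)).
Notation P2 := (fun z : C => lattice_sum (term2 a b z)).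
Notation P3 := (fun z : C => lattice_sum (term3 a b z)).

Lemma series_equation z : ~ in_lattice (RtoC a) (0, b) z ->
  exists d : C, @is_derive C_AbsRing C_NormedModule P z d /\
    (d * d = 4 * (P z * P z * P z) - RtoC g2 * P z - RtoC g3)%C.
Proof.
  intros Hz. destruct (HW z Hz) as (d & D1 & D2). exists d.
  rewrite <- wp_lattice_sum. split; auto.
  eapply is_derive_ext; [|exact D1]. intros t. apply wp_lattice_sum.
Qed.

Lemma strip_not_lattice z : strip b z -> ~ in_lattice (RtoC a) (0, b) z.
Proof.
  intros Hz (m & n & E). rewrite lattice_point_lat in E.
  unfold strip in Hz. rewrite E in Hz. unfold lat, Im in Hz; cbn in Hz.
  assert (H1 : 0 < IZR n < 1) by nra. destruct H1 as [H1 H2].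
  apply lt_IZR in H1. apply lt_IZR in H2. lia.
Qed.

Lemma strip_open z : strip b z ->
  exists delta, 0 < delta /\ forall h, Cmod h < delta -> strip b (z + h)%C.
Proof.
  intros Hz. destruct (recip_bound a b Ha Hb z Hz) as (C1 & delta & _ & Hd & Hh).
  exists delta. split; auto. intros h H. now apply Hh.
Qed.

Lemma Cder_zero_on_strip (f : C -> C) (z d : C) :
  (forall z, strip b z -> f z = RtoC 0) -> strip b z -> Cder f z d -> d = RtoC 0.
Proof.
  intros Hf Hz Hd. apply (Cder_unique f z); auto. apply Cder_intro.
  intros eps He. destruct (strip_open z Hz) as (delta & H0 & Hh).
  exists delta. split; auto. intros h H.
  rewrite !Hf; auto.
  replace (RtoC 0 - RtoC 0 - h * RtoC 0)%C with (RtoC 0) by ring.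
  rewrite Cmod_0. pose proof (Cmod_ge_0 h). nra.
Qed.

Lemma P1_square z : strip b z ->
  (P1 z * P1 z = 4 * (P z * P z * P z) - RtoC g2 * P z - RtoC g3)%C.
Proof.
  intros Hz. destruct (series_equation z (strip_not_lattice z Hz)) as (d & D1 & D2).
  rewrite <- D2. destruct (series_Cder a b Ha Hb z Hz) as [D _].
  now rewrite (Cder_unique _ _ _ _ (or_intror D1) D).
Qed.

(** Its vanishing spreads from the pole by way of the products of the defect with
    the derivatives of [P]. *)
Definition defect (z : C) : C := (P2 z + RtoC (-6) * (P z * P z) + RtoC (g2 / 2))%C.

Lemma defect_Cder z : strip b z ->
  Cder defect z (P3 z + RtoC (-12) * (P z * P1 z))%C.
Proof.
  intros Hz. destruct (series_Cder a b Ha Hb z Hz) as (D1 & D2 & D3).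
  pose proof (Cder_plus _ _ _ _ _ (Cder_plus _ _ _ _ _ D3
     (Cder_mult _ _ _ _ _ (Cder_const (RtoC (-6)) z) (Cder_mult _ _ _ _ _ D1 D1)))
     (Cder_const (RtoC (g2 / 2)) z)) as D.
  cbv beta in D. unfold defect.
  match type of D with Cder _ _ ?x =>
    replace (P3 z + RtoC (-12) * (P z * P1 z))%C with x end; [exact D|].
  replace (RtoC (-12)) with (RtoC 2 * RtoC (-6))%C
    by (rewrite <- RtoC_mult; f_equal; ring).
  ring.
Qed.

Lemma Cmult_integral (x y : C) : (x * y)%C = RtoC 0 -> x = RtoC 0 \/ y = RtoC 0.
Proof.
  intros H. destruct (Ceq_dec x (RtoC 0)); auto. right.
  replace y with (/ x * (x * y))%C by (field; auto). rewrite H. ring.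
Qed.

Lemma P1_defect z : strip b z -> (P1 z * defect z = 0)%C.
Proof.
  intros Hz. destruct (series_Cder a b Ha Hb z Hz) as (D1 & D2 & D3).
  pose proof (Cder_plus _ _ _ _ _ (Cder_plus _ _ _ _ _ (Cder_plus _ _ _ _ _
     (Cder_mult _ _ _ _ _ D2 D2)
     (Cder_mult _ _ _ _ _ (Cder_const (RtoC (-4)) z)
        (Cder_mult _ _ _ _ _ (Cder_mult _ _ _ _ _ D1 D1) D1)))
     (Cder_mult _ _ _ _ _ (Cder_const (RtoC g2) z) D1))
     (Cder_const (RtoC g3) z)) as D.
  apply (Cder_zero_on_strip _ z) in D; auto.
  - cbv beta in D.
    assert (E : (RtoC 2 * (P1 z * defect z) = 0)%C).
    { rewrite <- D. unfold defect.
      replace (RtoC g2) with (RtoC 2 * RtoC (g2 / 2))%C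
        by (rewrite <- RtoC_mult; f_equal; field).
      replace (RtoC (-4)) with (- (RtoC 2 * RtoC 2))%C
        by (rewrite <- RtoC_mult, <- RtoC_opp; f_equal; ring).
      replace (RtoC (-6)) with (- (RtoC 2 * (RtoC 2 + RtoC 1)))%C
        by (rewrite <- RtoC_plus, <- RtoC_mult, <- RtoC_opp; f_equal; ring).
      ring. }
    apply Cmult_integral in E as [E|E]; auto.
    exfalso. apply (f_equal Re) in E. cbn in E. lra.
  - intros w Hw. cbv beta. rewrite P1_square by auto. cbv beta.
    replace (RtoC (-4)) with (- RtoC 4)%C by (rewrite <- RtoC_opp; f_equal; ring). ring.
Qed.

(** Multiply the derivative of [q * defect = 0] by [defect]: the second summand
    vanishes, and [dq * defect^2 = 0] remains. *)
Lemma defect_propagates (q dq : C -> C) :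
  (forall z, strip b z -> Cder q z (dq z)) ->
  (forall z, strip b z -> (q z * defect z = 0)%C) ->
  forall z, strip b z -> (dq z * defect z = 0)%C.
Proof.
  intros Hq H0 z Hz.
  pose proof (Cder_mult _ _ _ _ _ (Hq z Hz) (defect_Cder z Hz)) as D.
  apply (Cder_zero_on_strip _ z) in D; auto.
  set (e := (P3 z + RtoC (-12) * (P z * P1 z))%C) in *.
  assert (E : (dq z * defect z * defect z = 0)%C).
  { replace (dq z * defect z * defect z)%C
      with ((dq z * defect z + q z * e) * defect z - (q z * defect z) * e)%C by ring.
    rewrite D, H0 by auto. ring. }
  apply Cmult_integral in E as [E|E]; auto. rewrite E. ring.
Qed.

(** The derivative of the defect is a combination of [P3] and [P P1], both of which
    the defect annihilates. *)
Lemma defect_square_Cder z : strip b z -> Cder (fun z => defect z * defect z)%C z (RtoC 0).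
Proof.
  intros Hz. pose proof (defect_Cder z Hz) as D.
  pose proof (Cder_mult _ _ _ _ _ D D) as DD.
  assert (H1 := P1_defect).
  assert (H2 := defect_propagates P1 P2 (fun z Hz => proj1 (proj2 (series_Cder a b Ha Hb z Hz))) H1).
  assert (H3 := defect_propagates P2 P3 (fun z Hz => proj2 (proj2 (series_Cder a b Ha Hb z Hz))) H2).
  specialize (H1 z Hz). specialize (H3 z Hz). cbv beta in H1, H3.
  match type of DD with Cder _ _ ?x => replace (RtoC 0) with x; [exact DD|] end.
  transitivity (RtoC 2 * (lattice_sum (term3 a b z) * defect z)
     + RtoC 2 * RtoC (-12) * lattice_sum (term0 a b z) * (lattice_sum (term1 a b z) * defect z))%C; [ring|].
  rewrite H1, H3. ring.
Qed.

Lemma series_large (M : R) : exists delta, 0 < delta /\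
  forall z, 0 < Cmod z < delta -> M < Cmod (P z).
Proof.
  destruct (series_pole a b Ha Hb) as (rho & K & Hr & HP).
  set (Q := 1 + Rabs M + Rabs K).
  assert (HQ : 1 <= Q) by (unfold Q; pose proof (Rabs_pos M); pose proof (Rabs_pos K); lra).
  assert (HiQ : 0 < / Q) by (apply Rinv_0_lt_compat; lra).
  exists (Rmin rho (/ Q)). split; [now apply Rmin_glb_lt|].
  intros z [Hz0 Hz].
  assert (H1 : Cmod z < rho) by (eapply Rlt_le_trans; [apply Hz|apply Rmin_l]).
  assert (H2 : Cmod z < / Q) by (eapply Rlt_le_trans; [apply Hz|apply Rmin_r]).
  specialize (HP z H1). cbv beta.
  assert (Hzn : z <> RtoC 0) by now apply Cmod_gt_0.
  assert (L : Q < / Cmod z).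
  { rewrite <- (Rinv_inv Q). apply Rinv_lt_contravar; auto. now apply Rmult_lt_0_compat. }
  pose proof (Cmod_triangle (lattice_sum (term0 a b z)) (- (lattice_sum (term0 a b z) - / z * / z))%C) as T.
  replace (lattice_sum (term0 a b z) + - (lattice_sum (term0 a b z) - / z * / z))%C with (/ z * / z)%C in T by ring.
  rewrite Cmod_opp, Cmod_mult, Cmod_inv in T by auto.
  assert (Q <= / Cmod z * / Cmod z) by nra.
  pose proof (Rle_abs M). pose proof (Rle_abs K). unfold Q in *. lra.
Qed.

(** Zeros of [P1] are points where [P] takes one of three values, hence a bounded
    one; this keeps them away from the pole. *)
Lemma root_bound (w : C) : (4 * (w * w * w) - RtoC g2 * w - RtoC g3 = 0)%C ->
  Cmod w <= 1 + Rabs g2 + Rabs g3.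
Proof.
  intros H. pose proof (Rabs_pos g2). pose proof (Rabs_pos g3).
  destruct (Rle_lt_dec (Cmod w) (1 + Rabs g2 + Rabs g3)) as [L|L]; auto.
  exfalso.
  assert (E : (4 * (w * w * w) = RtoC g2 * w + RtoC g3)%C).
  { replace (4 * (w * w * w))%C with
      ((4 * (w * w * w) - RtoC g2 * w - RtoC g3) + (RtoC g2 * w + RtoC g3))%C by ring.
    rewrite H. ring. }
  apply (f_equal Cmod) in E. rewrite !Cmod_mult in E.
  pose proof (Cmod_triangle (RtoC g2 * w)%C (RtoC g3)) as T.
  rewrite Cmod_mult in T. rewrite !Cmod_R in *. rewrite (Rabs_pos_eq 4) in E by lra.
  set (x := Cmod w) in *.
  assert (x * x * 1 <= x * x * x) by (apply Rmult_le_compat_l; nra).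
  assert (Rabs g2 * x + Rabs g3 * x <= x * x) by nra.
  assert (Rabs g3 * 1 <= Rabs g3 * x) by (apply Rmult_le_compat_l; lra).
  assert (0 < x * x) by nra. lra.
Qed.

Lemma ray_strip (z : C) s : strip b z -> 0 < s <= 1 -> strip b (RtoC 0 + RtoC s * z)%C.
Proof.
  unfold strip. intros Hz Hs.
  replace (Im (RtoC 0 + RtoC s * z)%C) with (s * Im z) by (unfold Im; cbn; ring). nra.
Qed.

(** Along a ray from the pole the square of the defect is constant, and it vanishes
    near the pole, where [P1] has no zero. *)
Lemma P2_equation z : strip b z ->
  (P2 z = 6 * (P z * P z) - RtoC (g2 / 2))%C.
Proof.
  intros Hz.
  assert (Hz0 : 0 < Cmod z).
  { destruct Hz as [Hz _]. eapply Rlt_le_trans; [apply Hz|].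
    eapply Rle_trans; [apply Rle_abs|apply im_le_Cmod]. }
  destruct (series_large (1 + Rabs g2 + Rabs g3)) as (delta & Hd & HP).
  set (s0 := Rmin 1 (delta / Cmod z) / 2).
  assert (Hm : 0 < Rmin 1 (delta / Cmod z)) by (apply Rmin_glb_lt; [lra|now apply Rdiv_lt_0_compat]).
  assert (Hs0 : 0 < s0 < 1) by (unfold s0; pose proof (Rmin_l 1 (delta / Cmod z)); lra).
  assert (Hs1 : s0 * Cmod z < delta).
  { apply Rmult_lt_reg_r with (/ Cmod z); [now apply Rinv_0_lt_compat|].
    rewrite Rmult_assoc, Rinv_r, Rmult_1_r by lra.
    fold (delta / Cmod z). unfold s0. pose proof (Rmin_r 1 (delta / Cmod z)). lra. }
  set (ray := fun s => (RtoC 0 + RtoC s * z)%C).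
  assert (Z0 : defect (ray s0) = RtoC 0).
  { assert (St : strip b (ray s0)) by (apply ray_strip; auto; lra).
    destruct (Cmult_integral _ _ (P1_defect _ St)) as [E|E]; auto. exfalso.
    assert (M : Cmod (ray s0) = s0 * Cmod z).
    { unfold ray. rewrite Cplus_0_l, Cmod_mult, Cmod_R, Rabs_pos_eq; lra. }
    assert (HL : 1 + Rabs g2 + Rabs g3 < Cmod (P (ray s0))).
    { apply HP. rewrite M. nra. }
    apply (Rlt_not_le _ _ HL), root_bound.
    rewrite <- (P1_square _ St). cbv beta. cbv beta in E. rewrite E. ring. }
  assert (D : forall s, s0 <= s <= 1 ->
     is_derive (fun s => Re (defect (ray s) * defect (ray s))%C) s zero /\
     is_derive (fun s => Im (defect (ray s) * defect (ray s))%C) s zero).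
  { intros s Hs.
    assert (St : strip b (ray s)) by (apply ray_strip; auto; lra).
    destruct (Cder_path _ _ _ _ _ (or_introl (defect_square_Cder _ St))) as [D1 D2].
    replace (z * RtoC 0)%C with (RtoC 0) in D1, D2 by ring. split; assumption. }
  assert (Z1 : (defect (ray 1) * defect (ray 1) = 0)%C).
  { pose proof (eq_is_derive _ s0 1 (fun s Hs => proj1 (D s Hs)) (proj2 Hs0)) as E1.
    pose proof (eq_is_derive _ s0 1 (fun s Hs => proj2 (D s Hs)) (proj2 Hs0)) as E2.
    cbv beta in E1, E2. rewrite Z0, Cmult_0_l in E1, E2.
    destruct (defect (ray 1) * defect (ray 1))%C as [x y].
    unfold Re, Im, RtoC in *; cbn in *. now rewrite <- E1, <- E2. }
  assert (Z : defect z = RtoC 0).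
  { replace (ray 1) with z in Z1 by (unfold ray; ring).
    now destruct (Cmult_integral _ _ Z1). }
  unfold defect in Z. cbv beta in *.
  replace (lattice_sum (term2 a b z)) with
    (lattice_sum (term2 a b z) + RtoC (-6) * (lattice_sum (term0 a b z) * lattice_sum (term0 a b z)) + RtoC (g2 / 2)
     + (RtoC 6 * (lattice_sum (term0 a b z) * lattice_sum (term0 a b z)) - RtoC (g2 / 2)))%C.
  - rewrite Z. ring.
  - replace (RtoC (-6)) with (- RtoC 6)%C by (rewrite <- RtoC_opp; f_equal; ring). ring.
Qed.
End Equation.

(** * The Weierstrass function on the line through i b *)

Section Line.
Variables (a b g2 g3 : R).
Hypotheses (Ha : 0 < a) (Hb : 0 < b).
Hypothesis (HW : weierstrass_equation (RtoC a) (0, b) g2 g3).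

Notation P := (fun z : C => lattice_sum (term0 a b z)).
Notation P1 := (fun z : C => lattice_sum (term1 a b z)).
Notation P2 := (fun z : C => lattice_sum (term2 a b z)).

(** On the imaginary axis [P] and its translate by [q] solve the same second-order
    equation. As they agree at [i b] to first order, they agree all the way down
    to the pole at [0], but the translate stays bounded there. *)
Lemma no_short_period (q : R) : 0 < q < 2 * a ->
  P (RtoC q + RtoC b * Ci)%C = P (RtoC 0 + RtoC b * Ci)%C ->
  P1 (RtoC q + RtoC b * Ci)%C = P1 (RtoC 0 + RtoC b * Ci)%C -> False.
Proof.
  intros Hq EP EP1. cbv beta in EP, EP1.
  assert (Hql : ~ in_lattice (RtoC a) (0, b) (RtoC q)).
  { intros (m & n & E). rewrite lattice_point_lat in E.
    apply (f_equal Re) in E. cbn in E.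
    assert (H1 : 0 < IZR m < 1) by nra. destruct H1 as [H1 H2].
    apply lt_IZR in H1. apply lt_IZR in H2. lia. }
  destruct (series_equation a b g2 g3 HW _ Hql) as (d & Dd & _).
  destruct (Cder_elim _ _ _ (or_intror Dd) 1 Rlt_0_1) as (e1 & He1 & HB).
  destruct (series_large a b Ha Hb (Cmod (lattice_sum (term0 a b (RtoC q))) + Cmod d + 1)) as (e2 & He2 & HL).
  (* At height [s] the function exceeds a bound that its translate respects. *)
  set (s := Rmin (Rmin e1 e2) (Rmin 1 b) / 2).
  assert (Hm : 0 < Rmin (Rmin e1 e2) (Rmin 1 b)) by (repeat apply Rmin_glb_lt; lra).
  assert (Hs : 0 < s /\ s < e1 /\ s < e2 /\ s < 1 /\ s < b).
  { unfold s. pose proof (Rmin_l (Rmin e1 e2) (Rmin 1 b)).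
    pose proof (Rmin_r (Rmin e1 e2) (Rmin 1 b)).
    pose proof (Rmin_l e1 e2). pose proof (Rmin_r e1 e2).
    pose proof (Rmin_l 1 b). pose proof (Rmin_r 1 b). repeat split; lra. }
  destruct Hs as (Hs0 & Hs1 & Hs2 & Hs3 & Hs4). clearbody s.
  assert (MI : Cmod (RtoC s * Ci)%C = s).
  { rewrite Cmod_mult, Cmod_R, Cmod_Ci, Rabs_pos_eq; lra. }
  specialize (HL (RtoC 0 + RtoC s * Ci)%C). rewrite Cplus_0_l, MI in HL.
  specialize (HL (conj Hs0 Hs2)).
  specialize (HB (RtoC s * Ci)%C). rewrite MI in HB. specialize (HB Hs1).
  assert (St : forall x y, 0 < y <= b -> strip b (RtoC x + RtoC y * Ci)%C).
  { intros x y Hy. unfold strip, Im; cbn. lra. }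
  set (A := fun y => (RtoC 0 + RtoC y * Ci)%C). set (B := fun y => (RtoC q + RtoC y * Ci)%C).
  set (D0 := fun y => (lattice_sum (term0 a b (A y)) - lattice_sum (term0 a b (B y)))%C).
  set (D1 := fun y => (Ci * (lattice_sum (term1 a b (A y)) - lattice_sum (term1 a b (B y))))%C).
  set (cf := fun y => (- (RtoC 6 * (lattice_sum (term0 a b (A y)) + lattice_sum (term0 a b (B y)))))%C).
  assert (Der : forall x y, 0 < y <= b ->
    let z := fun y => (RtoC x + RtoC y * Ci)%C in
    is_derive (fun y => Re (lattice_sum (term0 a b (z y)))) y (Re (Ci * lattice_sum (term1 a b (z y)))%C) /\
    is_derive (fun y => Im (lattice_sum (term0 a b (z y)))) y (Im (Ci * lattice_sum (term1 a b (z y)))%C) /\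
    is_derive (fun y => Re (lattice_sum (term1 a b (z y)))) y (Re (Ci * lattice_sum (term2 a b (z y)))%C) /\
    is_derive (fun y => Im (lattice_sum (term1 a b (z y)))) y (Im (Ci * lattice_sum (term2 a b (z y)))%C)).
  { intros x y Hy z. destruct (series_Cder a b Ha Hb _ (St x y Hy)) as (X1 & X2 & _).
    destruct (Cder_path _ _ _ _ _ (or_introl X1)).
    destruct (Cder_path _ _ _ _ _ (or_introl X2)). auto. }
  assert (U : Re (D0 s) = 0 /\ Im (D0 s) = 0 /\ Re (D1 s) = 0 /\ Im (D1 s) = 0).
  { apply (linear_ode_unique (fun y => Re (D0 y)) (fun y => Im (D0 y))
       (fun y => Re (D1 y)) (fun y => Im (D1 y))
       (fun y => Re (cf y)) (fun y => Im (cf y)) b s).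
    - intros y Hy. rewrite Rmin_right, Rmax_left in Hy by lra.
      assert (Hy' : 0 < y <= b) by lra.
      destruct (Der 0 y Hy') as (A1 & A2 & A3 & A4).
      destruct (Der q y Hy') as (B1 & B2 & B3 & B4).
      pose proof (P2_equation a b g2 g3 Ha Hb HW _ (St 0 y Hy')) as QA.
      pose proof (P2_equation a b g2 g3 Ha Hb HW _ (St q y Hy')) as QB.
      cbv beta zeta in *. fold (A y) in *. fold (B y) in *.
      assert (Q : (Ci * (Ci * (lattice_sum (term2 a b (A y)) - lattice_sum (term2 a b (B y)))) = cf y * D0 y)%C).
      { rewrite QA, QB. unfold cf, D0.
        replace (Ci * (Ci * (6 * (lattice_sum (term0 a b (A y)) * lattice_sum (term0 a b (A y))) - RtoC (g2 / 2) -
          (6 * (lattice_sum (term0 a b (B y)) * lattice_sum (term0 a b (B y))) - RtoC (g2 / 2)))))%C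
          with ((Ci * Ci) * (RtoC 6 * (lattice_sum (term0 a b (A y)) + lattice_sum (term0 a b (B y))) *
             (lattice_sum (term0 a b (A y)) - lattice_sum (term0 a b (B y)))))%C by ring.
        replace (Ci * Ci)%C with (- RtoC 1)%C
          by (unfold Ci, RtoC, Cmult, Copp; cbn; f_equal; ring). ring. }
      pose proof (f_equal Re Q) as QR. pose proof (f_equal Im Q) as QI.
      split; [|split; [|split; [|split; [|split]]]].
      + evar_last; [apply (is_derive_minus _ _ _ _ _ A1 B1)|].
        unfold D1, Re, minus, plus, opp; cbn. ring.
      + evar_last; [apply (is_derive_minus _ _ _ _ _ A2 B2)|].
        unfold D1, Im, minus, plus, opp; cbn. ring.
      + replace (Re (cf y) * Re (D0 y) - Im (cf y) * Im (D0 y)) with (Re (cf y * D0 y)%C)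
          by reflexivity.
        rewrite <- QR.
        apply (is_derive_ext (fun y => (Im (lattice_sum (term1 a b (B y))) - Im (lattice_sum (term1 a b (A y)))))).
        { intros t. unfold D1, Re, Im; cbn. ring. }
        evar_last; [apply (is_derive_minus _ _ _ _ _ B4 A4)|].
        unfold Re, Im, minus, plus, opp; cbn. ring.
      + replace (Im (cf y) * Re (D0 y) + Re (cf y) * Im (D0 y)) with (Im (cf y * D0 y)%C)
          by (unfold Re, Im; cbn; ring).
        rewrite <- QI.
        apply (is_derive_ext (fun y => (Re (lattice_sum (term1 a b (A y))) - Re (lattice_sum (term1 a b (B y)))))).
        { intros t. unfold D1, Re, Im; cbn. ring. }
        evar_last; [apply (is_derive_minus _ _ _ _ _ A3 B3)|].
        unfold Re, Im, minus, plus, opp; cbn. ring.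
      + apply (ex_derive_continuous (K := R_AbsRing) (V := R_NormedModule) (fun y => Re (cf y))).
        eexists.
        apply (is_derive_ext (fun y => -6 * (Re (lattice_sum (term0 a b (A y))) + Re (lattice_sum (term0 a b (B y)))))).
        { intros t. unfold cf, Re, Im; cbn. ring. }
        apply (is_derive_scal _ _ (-6)). apply (is_derive_plus _ _ _ _ _ A1 B1).
      + apply (ex_derive_continuous (K := R_AbsRing) (V := R_NormedModule) (fun y => Im (cf y))).
        eexists.
        apply (is_derive_ext (fun y => -6 * (Im (lattice_sum (term0 a b (A y))) + Im (lattice_sum (term0 a b (B y)))))).
        { intros t. unfold cf, Re, Im; cbn. ring. }
        apply (is_derive_scal _ _ (-6)). apply (is_derive_plus _ _ _ _ _ A2 B2).
    - unfold D0, A, B. rewrite EP. unfold Cminus. rewrite Cplus_opp_r. reflexivity.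
    - unfold D0, A, B. rewrite EP. unfold Cminus. rewrite Cplus_opp_r. reflexivity.
    - unfold D1, A, B. rewrite EP1. unfold Cminus. rewrite Cplus_opp_r, Cmult_0_r. reflexivity.
    - unfold D1, A, B. rewrite EP1. unfold Cminus. rewrite Cplus_opp_r, Cmult_0_r. reflexivity. }
  destruct U as (U1 & U2 & _).
  assert (E : lattice_sum (term0 a b (A s)) = lattice_sum (term0 a b (B s))).
  { unfold D0 in U1, U2. destruct (lattice_sum (term0 a b (A s))), (lattice_sum (term0 a b (B s))).
    unfold Re, Im in *; cbn in *. f_equal; lra. }
  unfold A, B in E. rewrite Cplus_0_l in E. cbv beta in HL. rewrite E in HL.
  pose proof (Cmod_triangle (lattice_sum (term0 a b (RtoC q + RtoC s * Ci)) - lattice_sum (term0 a b (RtoC q))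
     - RtoC s * Ci * d)%C (lattice_sum (term0 a b (RtoC q)) + RtoC s * Ci * d)%C) as T.
  replace (lattice_sum (term0 a b (RtoC q + RtoC s * Ci)) - lattice_sum (term0 a b (RtoC q)) - RtoC s * Ci * d +
     (lattice_sum (term0 a b (RtoC q)) + RtoC s * Ci * d))%C with (lattice_sum (term0 a b (RtoC q + RtoC s * Ci)%C)) in T by ring.
  pose proof (Cmod_triangle (lattice_sum (term0 a b (RtoC q))) (RtoC s * Ci * d)%C) as term2.
  rewrite (Cmod_mult (RtoC s * Ci)%C d), MI in term2.
  pose proof (Cmod_ge_0 d). nra.
Qed.

Definition midline (t : R) : C := ((0, b) + RtoC t * RtoC 1)%C.

Lemma midline_strip t : strip b (midline t).
Proof. unfold strip, midline, Im; cbn. lra. Qed.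

(** All that the real analysis uses of the Weierstrass function. Its values are
    real on this line because conjugation sends [i b + t] to [- i b + t], which
    differs from it by a period. *)
Lemma wp_midline : exists f f' : R -> R,
  (forall t, wp (RtoC a) (0, b) ((0, b) + RtoC t)%C = RtoC (f t)) /\
  (forall t, is_derive f t (f' t)) /\
  (forall t, is_derive f' t (6 * (f t * f t) - g2 / 2)) /\
  (forall t, f' t * f' t = 4 * (f t * f t * f t) - g2 * f t - g3) /\
  (forall t, f (- t) = f t) /\
  (forall t, f (t + 2 * a) = f t) /\
  (forall q, 0 < q < 2 * a -> ~ (forall t, f (t + q) = f t)).
Proof.
  set (p := fun t => lattice_sum (term0 a b (midline t))). set (p1 := fun t => lattice_sum (term1 a b (midline t))).
  set (p2 := fun t => lattice_sum (term2 a b (midline t))).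
  assert (Der : forall t, is_derive (fun t => Re (p t)) t (Re (p1 t)) /\
    is_derive (fun t => Im (p t)) t (Im (p1 t)) /\
    is_derive (fun t => Re (p1 t)) t (Re (p2 t)) ).
  { intros t. destruct (series_Cder a b Ha Hb _ (midline_strip t)) as (X1 & X2 & _).
    destruct (Cder_path _ _ _ _ _ (or_introl X1)) as [Y1 Y2].
    destruct (Cder_path _ _ _ _ _ (or_introl X2)) as [Y3 _].
    rewrite Cmult_1_l in *. auto. }
  assert (Ev : forall t, p (- t) = p t).
  { intros t. unfold p. rewrite <- (series_period_snd a b Ha Hb (midline t)) by apply midline_strip.
    rewrite <- (series_even a b (midline (- t))). apply (f_equal (fun z => lattice_sum (term0 a b z))).
    unfold midline, RtoC, Cminus, Cplus, Copp, Cmult; cbn. f_equal; ring. }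
  assert (Re0 : forall t, Im (p t) = 0).
  { intros t.
    assert (H : p t = Cconj (p t)).
    { unfold p at 2. rewrite <- series_conj. unfold p.
      rewrite <- (series_period_snd a b Ha Hb (midline t)) by apply midline_strip.
      apply (f_equal (fun z => lattice_sum (term0 a b z))).
      unfold midline, RtoC, Cminus, Cplus, Copp, Cmult, Cconj; cbn. f_equal; ring. }
    apply (f_equal Im) in H. change (Im (p t) = - Im (p t)) in H. lra. }
  assert (Per : forall t, p (t + 2 * a) = p t).
  { intros t. unfold p.
    rewrite <- (series_period_fst a b Ha Hb (midline (t + 2 * a))) by apply midline_strip.
    apply (f_equal (fun z => lattice_sum (term0 a b z))).
    unfold midline, RtoC, Cminus, Cplus, Copp, Cmult; cbn. f_equal; ring. }
  assert (Re1 : forall t, Im (p1 t) = 0).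
  { intros t. destruct (Der t) as (_ & D2 & _).
    apply is_derive_unique in D2. rewrite <- D2.
    rewrite (Derive_ext _ (fun _ => 0)) by auto. apply Derive_const. }
  assert (RC : forall t, p t = RtoC (Re (p t)) /\ p1 t = RtoC (Re (p1 t))).
  { intros t. specialize (Re0 t). specialize (Re1 t). unfold RtoC.
    destruct (p t), (p1 t). unfold Re, Im in *; cbn in *. subst. auto. }
  exists (fun t => Re (p t)), (fun t => Re (p1 t)).
  split; [|split; [|split; [|split; [|split; [|split]]]]].
  - intros t. rewrite wp_lattice_sum. destruct (RC t) as [<- _]. unfold p, midline.
    now rewrite Cmult_1_r.
  - intros t. exact (proj1 (Der t)).
  - intros t. replace (6 * (Re (p t) * Re (p t)) - g2 / 2) with (Re (p2 t)); [exact (proj2 (proj2 (Der t)))|].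
    unfold p2. pose proof (P2_equation a b g2 g3 Ha Hb HW _ (midline_strip t)) as Q.
    cbv beta in Q. rewrite Q. fold (p t).
    destruct (RC t) as [-> _]. unfold RtoC, Re; cbn. ring.
  - intros t. pose proof (P1_square a b g2 g3 Ha Hb HW _ (midline_strip t)) as Q.
    cbv beta in Q. fold (p t) in Q. fold (p1 t) in Q.
    destruct (RC t) as [E E1]. rewrite E, E1 in Q. apply (f_equal Re) in Q.
    unfold RtoC, Re in *; cbn in *. ring_simplify in Q. lra.
  - intros t. now rewrite Ev.
  - intros t. now rewrite Per.
  - intros q Hq HP. apply (no_short_period q Hq); cbv beta.
    + replace (RtoC q + RtoC b * Ci)%C with (midline (0 + q))
        by (unfold midline, Ci, RtoC, Cplus, Cmult; cbn; f_equal; ring).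
      replace (RtoC 0 + RtoC b * Ci)%C with (midline 0)
        by (unfold midline, Ci, RtoC, Cplus, Cmult; cbn; f_equal; ring).
      change (p (0 + q) = p 0). destruct (RC (0 + q)) as [-> _], (RC 0) as [-> _].
      now rewrite (HP 0).
    + replace (RtoC q + RtoC b * Ci)%C with (midline (0 + q))
        by (unfold midline, Ci, RtoC, Cplus, Cmult; cbn; f_equal; ring).
      replace (RtoC 0 + RtoC b * Ci)%C with (midline 0)
        by (unfold midline, Ci, RtoC, Cplus, Cmult; cbn; f_equal; ring).
      change (p1 (0 + q) = p1 0). destruct (RC (0 + q)) as [_ ->], (RC 0) as [_ ->].
      f_equal. destruct (Der 0) as (D0 & _). destruct (Der (0 + q)) as (Dq & _).
      apply is_derive_unique in D0. rewrite <- D0.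
      rewrite <- (Derive_ext (fun t => Re (p (t + q)))) by auto.
      symmetry. apply is_derive_unique.
      exact (is_derive_shift (fun t => Re (p t)) q 0 _ Dq).
Qed.
End Line.

(** * Flow lines *)

Lemma is_derive_zero_const_between (f : R -> R) (s t : R) :
  (forall x, Rmin s t <= x <= Rmax s t -> is_derive f x 0) -> f s = f t.
Proof.
  intros H. destruct (MVT_gen f s t (fun _ => 0)) as (c & _ & E).
  - intros x Hx. apply H. lra.
  - intros x Hx. apply derivable_continuous_pt. exists 0. now apply is_derive_Reals, H.
  - lra.
Qed.

Lemma between_interval (lo hi : Rbar) t0 t x :
  in_interval lo hi t0 -> in_interval lo hi t -> Rmin t0 t <= x <= Rmax t0 t ->
  in_interval lo hi x.
Proof.
  intros [A1 A2] [B1 B2] [C1 C2]. split.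
  - apply Rbar_lt_le_trans with (Rmin t0 t); [|exact C1].
    unfold Rmin. now destruct (Rle_dec t0 t).
  - apply Rbar_le_lt_trans with (Rmax t0 t); [exact C2|].
    unfold Rmax. now destruct (Rle_dec t0 t).
Qed.

Lemma whole_line t : in_interval m_infty p_infty t.
Proof. split; exact I. Qed.

Lemma period_nat (g : R -> R) (p : R) (n : nat) :
  (forall t, g (t + p) = g t) -> forall t, g (t + INR n * p) = g t.
Proof.
  intros H. induction n; intros t; [now rewrite Rmult_0_l, Rplus_0_r|].
  rewrite S_INR. replace (t + (INR n + 1) * p) with (t + INR n * p + p) by ring.
  now rewrite H.
Qed.

Lemma period_Z (g : R -> R) (p : R) (k : Z) :
  (forall t, g (t + p) = g t) -> forall t, g (t + IZR k * p) = g t.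
Proof.
  intros H t. destruct (Z_le_gt_dec 0 k) as [L|L].
  - rewrite <- (Z2Nat.id k), <- INR_IZR_INZ by lia. now apply period_nat.
  - rewrite <- (period_nat g p (Z.to_nat (- k)) H).
    rewrite INR_IZR_INZ, Z2Nat.id, opp_IZR by lia. f_equal. ring.
Qed.

Lemma reduce_mod (T x : R) : 0 < T -> exists k : Z, 0 <= x + IZR k * T < T.
Proof.
  intros HT. destruct (archimed (x / T)) as [A1 A2].
  exists (1 - up (x / T))%Z. rewrite minus_IZR.
  replace (x + (1 - IZR (up (x / T))) * T) with ((x / T + 1 - IZR (up (x / T))) * T)
    by (field; lra).
  split.
  - apply Rmult_le_pos; lra.
  - apply Rlt_le_trans with (1 * T); [apply Rmult_lt_compat_r|]; lra.
Qed.

Lemma product_conserved (lo hi : Rbar) (y1 y2 y3 : R -> R) (t0 : R) :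
  flow_solution lo hi y1 y2 y3 -> in_interval lo hi t0 ->
  conserved_value lo hi y1 y2 y3 (y1 t0 * y2 t0 * y3 t0).
Proof.
  intros HF H0 t Ht.
  apply (is_derive_zero_const_between (fun t => y1 t * y2 t * y3 t) t t0).
  intros x Hx. rewrite Rmin_comm, Rmax_comm in Hx.
  destruct (HF x (between_interval _ _ _ _ _ H0 Ht Hx)) as (_ & D1 & D2 & D3).
  assert (X1 : ex_derive (fun x => y1 x) x) by (eexists; exact D1).
  assert (X2 : ex_derive (fun x => y2 x) x) by (eexists; exact D2).
  assert (X3 : ex_derive (fun x => y3 x) x) by (eexists; exact D3).
  apply is_derive_unique in D1, D2, D3.
  auto_derive; [repeat split; auto|].
  change (Derive (fun x => y1 x) x) with (Derive y1 x).
  change (Derive (fun x => y2 x) x) with (Derive y2 x).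
  change (Derive (fun x => y3 x) x) with (Derive y3 x).
  rewrite D1, D2, D3. ring.
Qed.

(** Since [y2 + y3 = 1 - y1] and [y2 y3 = c / y1], a flow line is determined by
    [U = c / y1] and its logarithmic derivative [y3 - y2]. *)
Lemma flow_reduced (lo hi : Rbar) (y1 y2 y3 : R -> R) (c : R) :
  flow_solution lo hi y1 y2 y3 -> conserved_value lo hi y1 y2 y3 c ->
  let U t := y2 t * y3 t in let V t := y2 t * y3 t * (y3 t - y2 t) in
  forall t, in_interval lo hi t ->
    is_derive U t (V t) /\ is_derive V t (U t - c - 6 * (U t * U t)) /\
    V t * V t = (U t - c) * (U t - c) - 4 * (U t * U t * U t) /\ c < U t /\
    y1 t = c / U t /\ y2 t = (U t - c - V t) / (2 * U t) /\ y3 t = (U t - c + V t) / (2 * U t).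
Proof.
  intros HF HC U V t Ht.
  destruct (HF t Ht) as ((P1 & P2 & P3 & S) & D1 & D2 & D3).
  pose proof (HC t Ht) as C.
  assert (E1 : y1 t = 1 - y2 t - y3 t) by lra.
  assert (X2 : ex_derive (fun x => y2 x) t) by (eexists; exact D2).
  assert (X3 : ex_derive (fun x => y3 x) t) by (eexists; exact D3).
  apply is_derive_unique in D2, D3.
  assert (HU : 0 < U t) by (unfold U; now apply Rmult_lt_0_compat).
  assert (HUc : U t - c = U t * (y2 t + y3 t)) by (unfold U; rewrite <- C, E1; ring).
  split; [|split; [|split; [|split; [|split; [|split]]]]].
  - unfold U, V. auto_derive; [auto|].
    change (Derive (fun x => y2 x) t) with (Derive y2 t).
    change (Derive (fun x => y3 x) t) with (Derive y3 t). rewrite D2, D3. ring.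
  - unfold V. auto_derive; [repeat split; auto|].
    change (Derive (fun x => y2 x) t) with (Derive y2 t).
    change (Derive (fun x => y3 x) t) with (Derive y3 t). rewrite D2, D3, HUc.
    unfold U. rewrite E1. ring.
  - rewrite HUc. unfold U, V. ring.
  - assert (0 < U t * (y2 t + y3 t)) by (apply Rmult_lt_0_compat; lra). lra.
  - rewrite <- C. unfold U. field. lra.
  - rewrite HUc. unfold U, V. field. lra.
  - rewrite HUc. unfold U, V. field. lra.
Qed.

(** * The closed orbit *)

(** [u] stands for [1/12 - wp] on the line through [i b], as a function of the
    real part. *)
Section Orbit.
Variables (c T : R) (u v : R -> R).
Hypotheses (Hc : 0 < c) (HT : 0 < T).
Hypothesis Hu : forall t, is_derive u t (v t).
Hypothesis Hv : forall t, is_derive v t (u t - c - 6 * (u t * u t)).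
Hypothesis Hq : forall t, v t * v t = (u t - c) * (u t - c) - 4 * (u t * u t * u t).
Hypothesis Heven : forall t, u (- t) = u t.
Hypothesis Hper : forall t, u (t + T) = u t.
Hypothesis Hmin : forall q, 0 < q < T -> ~ (forall t, u (t + q) = u t).

Lemma ode_unique (lo hi : Rbar) (U V : R -> R) (s t0 : R) :
  (forall t, in_interval lo hi t ->
     is_derive U t (V t) /\ is_derive V t (U t - c - 6 * (U t * U t))) ->
  in_interval lo hi t0 -> U t0 = u (t0 + s) -> V t0 = v (t0 + s) ->
  forall t, in_interval lo hi t -> U t = u (t + s) /\ V t = v (t + s).
Proof.
  intros H H0 EU EV t Ht.
  assert (G : U t - u (t + s) = 0 /\ 0 = 0 /\ V t - v (t + s) = 0 /\ 0 = 0).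
  { apply (linear_ode_unique (fun t => U t - u (t + s)) (fun _ => 0)
       (fun t => V t - v (t + s)) (fun _ => 0)
       (fun t => 1 - 6 * (U t + u (t + s))) (fun _ => 0) t0 t).
    - intros x Hx. pose proof (between_interval _ _ _ _ _ H0 Ht Hx) as Hx'.
      destruct (H x Hx') as [H1 H2].
      pose proof (is_derive_shift u s x _ (Hu (x + s))) as S1.
      pose proof (is_derive_shift v s x _ (Hv (x + s))) as S2.
      split; [|split; [|split; [|split; [|split]]]].
      + apply (is_derive_minus _ _ _ _ _ H1 S1).
      + apply (is_derive_const (K := R_AbsRing) (V := R_NormedModule) 0).
      + evar_last; [apply (is_derive_minus _ _ _ _ _ H2 S2)|].
        unfold minus, plus, opp; cbn. ring.
      + replace (0 * (U x - u (x + s)) + (1 - 6 * (U x + u (x + s))) * 0) with 0 by ring.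
        apply (is_derive_const (K := R_AbsRing) (V := R_NormedModule) 0).
      + apply (ex_derive_continuous (K := R_AbsRing) (V := R_NormedModule)
           (fun t => 1 - 6 * (U t + u (t + s)))).
        eexists. apply (is_derive_minus (fun _ => 1)).
        * apply (is_derive_const (K := R_AbsRing) (V := R_NormedModule) 1).
        * apply (is_derive_scal _ _ 6). apply (is_derive_plus _ _ _ _ _ H1 S1).
      + apply continuous_const.
    - lra.
    - reflexivity.
    - lra.
    - reflexivity. }
  destruct G as (G1 & _ & G3 & _). split; lra.
Qed.

Lemma v_odd t : v (- t) = - v t.
Proof.
  pose proof (is_derive_reflect u 0 t (v (0 - t)) (Hu _)) as D.
  apply is_derive_unique in D.
  rewrite (Derive_ext _ u) in D.
  2:{ intros x. replace (0 - x) with (- x) by ring. apply Heven. }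
  rewrite (is_derive_unique _ _ _ (Hu t)) in D.
  replace (- t) with (0 - t) by ring. lra.
Qed.

(** Otherwise the remainder modulo [T] would be a smaller period. *)
Lemma period_multiple (q : R) : (forall t, u (t + q) = u t) -> exists k : Z, q = IZR k * T.
Proof.
  intros H. destruct (reduce_mod T q HT) as (k & K1 & K2).
  destruct (Req_dec (q + IZR k * T) 0) as [E|E].
  - exists (- k)%Z. rewrite opp_IZR. lra.
  - exfalso. apply (Hmin (q + IZR k * T)); [lra|]. intros t.
    rewrite <- Rplus_assoc. rewrite (period_Z u T k Hper). apply H.
Qed.

Lemma u_continuous t : continuity_pt u t.
Proof. apply derivable_continuous_pt. exists (v t). apply is_derive_Reals, Hu. Qed.

Lemma v_continuous t : continuity_pt v t.
Proof.
  apply derivable_continuous_pt. exists (u t - c - 6 * (u t * u t)).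
  apply is_derive_Reals, Hv.
Qed.

Lemma extremum_exists : exists m M, (forall t, u m <= u t <= u M).
Proof.
  destruct (continuity_ab_min u 0 T) as (m & Hm & _); [lra|intros; apply u_continuous|].
  destruct (continuity_ab_maj u 0 T) as (M & HM & _); [lra|intros; apply u_continuous|].
  exists m, M. intros t. destruct (reduce_mod T t HT) as (k & K).
  rewrite <- (period_Z u T k Hper t). split; [apply Hm|apply HM]; lra.
Qed.

Lemma v_min m : (forall t, u m <= u t) -> v m = 0.
Proof.
  intros H.
  assert (D : derivable_pt_lim u m (v m)) by (apply is_derive_Reals, Hu).
  rewrite <- (derive_pt_eq_0 _ _ _ (exist _ _ D) D).
  apply (deriv_minimum u (m - 1) (m + 1)); try lra. intros; apply H.
Qed.

Lemma v_max m : (forall t, u t <= u m) -> v m = 0.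
Proof.
  intros H.
  assert (D : derivable_pt_lim u m (v m)) by (apply is_derive_Reals, Hu).
  rewrite <- (derive_pt_eq_0 _ _ _ (exist _ _ D) D).
  apply (deriv_maximum u (m - 1) (m + 1)); try lra. intros; apply H.
Qed.

Lemma mean_value_u (s t : R) : s < t -> exists x, s < x < t /\ u t - u s = v x * (t - s).
Proof.
  intros Hst. destruct (MVT_cor2 u v s t Hst) as (x & E & Hx).
  - intros x _. apply is_derive_Reals, Hu.
  - exists x. auto.
Qed.

Lemma min_second m : (forall t, u m <= u t) -> 0 <= u m - c - 6 * (u m * u m).
Proof.
  intros H. pose proof (v_min m H) as V0.
  destruct (Rle_lt_dec 0 (u m - c - 6 * (u m * u m))) as [L|L]; auto. exfalso.
  pose proof (Hv m) as D. apply is_derive_Reals in D.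
  set (l := u m - c - 6 * (u m * u m)) in *.
  destruct (D (- l / 2)) as (del & Hd); [lra|].
  pose proof (cond_pos del) as Hdel.
  destruct (mean_value_u m (m + del / 2)) as (x & Hx & E); [lra|].
  specialize (Hd (x - m)). rewrite V0 in Hd. replace (m + (x - m)) with x in Hd by ring.
  assert (Hxm : 0 < x - m) by lra.
  assert (Q : Rabs ((v x - 0) / (x - m) - l) < - l / 2).
  { apply Hd; [lra|]. rewrite Rabs_pos_eq; lra. }
  apply Rabs_lt_between in Q.
  assert (Vx : v x < 0).
  { assert (Q1 : (v x - 0) / (x - m) < 0) by lra.
    replace (v x) with ((v x - 0) / (x - m) * (x - m)) by (field; lra).
    apply Rmult_neg_pos; lra. }
  specialize (H (m + del / 2)).
  replace (m + del / 2 - m) with (del / 2) in E by ring.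
  assert (v x * (del / 2) < 0) by (apply Rmult_neg_pos; lra). lra.
Qed.

(** At its minimum [u] is a root of [(x - c)^2 - 4 x^3]. A root below [c] is
    excluded, as [u''] would be negative there. *)
Lemma u_gt t : c < u t.
Proof.
  destruct extremum_exists as (m & M & H).
  assert (Hm : forall t, u m <= u t) by (intros; apply H).
  apply Rlt_le_trans with (u m); auto.
  pose proof (min_second m Hm) as S. pose proof (Hq m) as Q. rewrite (v_min m Hm) in Q.
  assert (P0 : 0 < u m).
  { destruct (Rle_lt_dec (u m) 0) as [L|L]; auto. exfalso.
    assert (0 < (u m - c) * (u m - c)) by (apply Rmult_neg_neg; lra).
    assert (0 <= u m * u m) by (apply Rle_0_sqr).
    assert (u m * u m * u m <= 0).
    { rewrite <- (Rmult_0_r (u m * u m)). apply Rmult_le_compat_l; lra. }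
    lra. }
  assert (0 < u m * u m) by (apply Rmult_lt_0_compat; lra). lra.
Qed.

Lemma min_lt_max m M : (forall t, u m <= u t <= u M) -> u m < u M.
Proof.
  intros H. destruct (Rlt_le_dec (u m) (u M)) as [L|L]; auto. exfalso.
  apply (Hmin (T / 2)); [lra|]. intros t.
  pose proof (H t). pose proof (H (t + T / 2)). lra.
Qed.

(** The third root of the cubic lies below [c], so the level curve in the
    region [c < x] sits over the interval between the extrema of [u]. *)
Lemma level_range m M x : (forall t, u m <= u t <= u M) -> c < x ->
  0 <= (x - c) * (x - c) - 4 * (x * x * x) -> u m <= x <= u M.
Proof.
  intros H Hx HR.
  pose proof (min_lt_max m M H) as L.
  pose proof (u_gt m) as Gm. pose proof (u_gt M) as GM.
  pose proof (Hq m) as Qm. rewrite (v_min m) in Qm by apply H.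
  pose proof (Hq M) as QM. rewrite (v_max M) in QM by apply H.
  set (p := u m) in *. set (q := u M) in *. clearbody p q. clear H.
  set (r := 1 / 4 - p - q).
  assert (E1 : p + q - 2 * c = 4 * (p * p + p * q + q * q)).
  { apply Rmult_eq_reg_l with (q - p); [|lra]. lra. }
  assert (F : forall y, (y - c) * (y - c) - 4 * (y * y * y) = -4 * ((y - p) * (y - q) * (y - r))).
  { intros y. unfold r.
    assert (E2 : c * c = 4 * (p * p * p) - p * p + 2 * c * p) by lra.
    replace ((y - c) * (y - c)) with (y * y - 2 * c * y + c * c) by ring. rewrite E2.
    replace (2 * c) with (p + q - 4 * (p * p + p * q + q * q)) by lra. field. }
  assert (Hr : r < c).
  { pose proof (F c) as Fc.
    assert (0 < c * c * c) by (repeat apply Rmult_lt_0_compat; lra).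
    assert (N : 0 < (c - p) * (c - q)) by (apply Rmult_neg_neg; lra).
    destruct (Rlt_le_dec r c) as [?|N2]; auto. exfalso.
    assert (0 <= (c - p) * (c - q) * (r - c)) by (apply Rmult_le_pos; lra).
    lra. }
  rewrite F in HR. clear F Qm QM E1. clearbody r.
  assert (N : (x - p) * (x - q) <= 0).
  { destruct (Rle_lt_dec ((x - p) * (x - q)) 0) as [?|N]; auto. exfalso.
    assert (0 < (x - p) * (x - q) * (x - r)) by (apply Rmult_lt_0_compat; lra). lra. }
  split; nra.
Qed.

(** The intermediate value theorem reaches [x]; the sign of the derivative is then
    adjusted by the reflection [t |-> - t]. *)
Lemma orbit_transitive x y : c < x -> y * y = (x - c) * (x - c) - 4 * (x * x * x) ->
  exists s, u s = x /\ v s = y.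
Proof.
  intros Hx Hy. destruct extremum_exists as (m & M & H).
  destruct (level_range m M x H Hx) as [R1 R2]; [rewrite <- Hy; apply Rle_0_sqr|].
  assert (S : exists s, u s = x).
  { destruct (IVT_gen u m M x) as (s & _ & E).
    - intros t. apply u_continuous.
    - pose proof (H M). rewrite Rmin_left, Rmax_right by lra. lra.
    - now exists s. }
  destruct S as (s & Es).
  assert (E : v s * v s = y * y) by (rewrite Hq, Es; lra).
  assert (E' : (v s - y) * (v s + y) = 0) by lra.
  apply Rmult_integral in E' as [E'|E'].
  - exists s. split; lra.
  - exists (- s). rewrite Heven, v_odd. split; lra.
Qed.

(** At a critical point [u] is symmetric; being even as well, it would have
    the period [2 t]. *)
Lemma v_neq0 t : 0 < t < T / 2 -> v t <> 0.
Proof.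
  intros Ht E. apply (Hmin (2 * t)); [lra|]. intros s.
  assert (G' : u (2 * t - (- s)) = u (- s + 0) /\ - v (2 * t - (- s)) = v (- s + 0)).
  { apply (ode_unique m_infty p_infty (fun x => u (2 * t - x))
     (fun x => - v (2 * t - x)) 0 t); try apply whole_line.
    - intros x _. split.
      + apply is_derive_reflect, Hu.
      + evar_last; [apply (is_derive_opp (fun x => v (2 * t - x))), is_derive_reflect, Hv|].
        unfold opp; cbn. ring.
    - f_equal. ring.
    - replace (2 * t - t) with t by ring. rewrite Rplus_0_r, E. ring. }
  destruct G' as [G' _].
  replace (s + 2 * t) with (2 * t - - s) by ring. rewrite G', Rplus_0_r. apply Heven.
Qed.

(** So [u] is monotone between [0] and [T/2], which fixes the direction of
    motion on that half-period. *)
Lemma v_same_sign s t : 0 < s < T / 2 -> 0 < t < T / 2 -> 0 < v s * v t.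
Proof.
  intros Hs Ht. destruct (Rlt_le_dec 0 (v s * v t)) as [L|L]; auto. exfalso.
  pose proof (v_neq0 s Hs) as Ns. pose proof (v_neq0 t Ht) as Nt.
  assert (Sg : v s < 0 < v t \/ v t < 0 < v s).
  { destruct (Rtotal_order (v s) 0) as [A1|[A1|A1]]; [|contradiction|];
      (destruct (Rtotal_order (v t) 0) as [A2|[A2|A2]]; [|contradiction|]); auto.
    - pose proof (Rmult_neg_neg _ _ A1 A2). lra.
    - pose proof (Rmult_lt_0_compat _ _ A1 A2). lra. }
  destruct (IVT_gen v s t 0) as (x & Hx & E).
  - intros x. apply v_continuous.
  - unfold Rmin, Rmax. destruct (Rle_dec (v s) (v t)); lra.
  - apply (v_neq0 x); auto.
    unfold Rmin, Rmax in Hx. destruct (Rle_dec s t); lra.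
Qed.

(** The inverse of the passage from a flow line to [(U, V)] in [flow_reduced]. *)
Definition eta1 (t : R) : R := c / u t.
Definition eta2 (t : R) : R := (u t - c - v t) / (2 * u t).
Definition eta3 (t : R) : R := (u t - c + v t) / (2 * u t).

Lemma u_pos t : 0 < u t.
Proof. pose proof (u_gt t). lra. Qed.

Lemma eta_flow : flow_solution m_infty p_infty eta1 eta2 eta3.
Proof.
  intros t _. pose proof (u_gt t) as G. pose proof (u_pos t) as P0.
  pose proof (Hq t) as Q.
  assert (V : - (u t - c) < v t < u t - c).
  { assert (0 < u t * u t * u t) by (repeat apply Rmult_lt_0_compat; lra).
    apply Rabs_lt_between. rewrite <- (Rabs_pos_eq (u t - c)) by lra.
    apply Rsqr_lt_abs_0. unfold Rsqr. lra. }
  assert (Du : Derive (fun x => u x) t = v t) by (apply is_derive_unique, Hu).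
  assert (Dv : Derive (fun x => v x) t = u t - c - 6 * (u t * u t))
    by (apply is_derive_unique, Hv).
  assert (Eu : ex_derive (fun x => u x) t) by (exists (v t); apply Hu).
  assert (Ev : ex_derive (fun x => v x) t)
    by (exists (u t - c - 6 * (u t * u t)); apply Hv).
  unfold eta1, eta2, eta3. split; [|split; [|split]].
  - split; [|split; [|split]].
    + apply Rdiv_lt_0_compat; lra.
    + apply Rdiv_lt_0_compat; lra.
    + apply Rdiv_lt_0_compat; lra.
    + field. lra.
  - auto_derive; [repeat split; auto; lra|]. rewrite Du. field. lra.
  - auto_derive; [repeat split; auto; lra|]. rewrite Du, Dv.
    apply Rminus_diag_uniq.
    transitivity (3 * (v t * v t - ((u t - c) * (u t - c) - 4 * (u t * u t * u t)))
                  / (4 * (u t * u t))); [field; lra|].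
    rewrite Q. field. lra.
  - auto_derive; [repeat split; auto; lra|]. rewrite Du, Dv.
    apply Rminus_diag_uniq.
    transitivity (-3 * (v t * v t - ((u t - c) * (u t - c) - 4 * (u t * u t * u t)))
                  / (4 * (u t * u t))); [field; lra|].
    rewrite Q. field. lra.
Qed.

Lemma eta_product t : eta1 t * eta2 t * eta3 t = c.
Proof.
  pose proof (u_pos t). unfold eta1, eta2, eta3.
  replace (c / u t * ((u t - c - v t) / (2 * u t)) * ((u t - c + v t) / (2 * u t)))
    with (c * ((u t - c) * (u t - c) - v t * v t) / (4 * (u t * u t * u t))) by (field; lra).
  rewrite Hq. field. lra.
Qed.

Lemma flow_is_shift (lo hi : Rbar) (y1 y2 y3 : R -> R) (t0 : R) :
  flow_solution lo hi y1 y2 y3 -> conserved_value lo hi y1 y2 y3 c ->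
  in_interval lo hi t0 ->
  exists s, forall t, in_interval lo hi t ->
    y1 t = eta1 (t + s) /\ y2 t = eta2 (t + s) /\ y3 t = eta3 (t + s).
Proof.
  intros HF HC H0. pose proof (flow_reduced _ _ _ _ _ _ HF HC) as R0. cbv zeta in R0.
  destruct (R0 t0 H0) as (_ & _ & Q & G & _).
  destruct (orbit_transitive _ _ G Q) as (s0 & Es & Ev).
  exists (s0 - t0). intros t Ht.
  destruct (ode_unique lo hi (fun t => y2 t * y3 t) (fun t => y2 t * y3 t * (y3 t - y2 t))
     (s0 - t0) t0) with (t := t) as [EU EV]; auto.
  - intros x Hx. destruct (R0 x Hx) as (D1 & D2 & _). auto.
  - now replace (t0 + (s0 - t0)) with s0 by ring.
  - now replace (t0 + (s0 - t0)) with s0 by ring.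
  - destruct (R0 t Ht) as (_ & _ & _ & _ & E1 & E2 & E3).
    cbv beta in EU, EV. rewrite EV, EU in E2, E3. rewrite EU in E1. auto.
Qed.

(** The cyclic permutation of a flow line is a flow line with the same product. *)
Lemma eta_cyclic : exists tau, forall t,
  eta2 t = eta1 (t + tau) /\ eta3 t = eta2 (t + tau) /\ eta1 t = eta3 (t + tau).
Proof.
  destruct (flow_is_shift m_infty p_infty eta2 eta3 eta1 0) as (tau & H).
  - intros t Ht. destruct (eta_flow t Ht) as ((P1 & P2 & P3 & S) & D1 & D2 & D3).
    repeat (split; [assumption|]). split; [|auto]. repeat (split; [assumption|]). lra.
  - intros t _. rewrite <- (eta_product t). ring.
  - apply whole_line.
  - exists tau. intros t. apply H, whole_line.
Qed.

Lemma eta1_period (k : Z) t : eta1 (t + IZR k * T) = eta1 t.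
Proof. unfold eta1. now rewrite (period_Z u T k Hper). Qed.

Lemma v_eta t : v t = u t * (eta3 t - eta2 t).
Proof. pose proof (u_pos t). unfold eta2, eta3. field. lra. Qed.

(** Advancing by a third of the period permutes the components. Three such
    shifts make a period, so the shift is [0], [T/3] or [2 T/3] up to periods;
    [0] would make the solution constant, and [2 T/3] would reverse the
    direction in which [u] runs on [(0, T/2)]. *)
Lemma eta_third t : eta2 t = eta1 (t + T / 3) /\ eta3 t = eta1 (t + 2 * (T / 3)).
Proof.
  destruct eta_cyclic as (tau & H).
  assert (P3 : forall t, u (t + 3 * tau) = u t).
  { intros x.
    assert (E : eta1 (x + 3 * tau) = eta1 x).
    { destruct (H x) as (_ & _ & ->). destruct (H (x + tau)) as (_ & -> & _).
      destruct (H (x + tau + tau)) as (-> & _ & _). f_equal. ring. }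
    pose proof (u_pos x). pose proof (u_pos (x + 3 * tau)). unfold eta1 in E.
    replace (u (x + 3 * tau)) with (c / (c / u (x + 3 * tau))) by (field; lra).
    rewrite E. field. lra. }
  destruct (period_multiple _ P3) as (k & Hk).
  set (j := (k / 3)%Z). set (r := (k mod 3)%Z).
  assert (Kjr : k = (3 * j + r)%Z) by (apply Z.div_mod; lia).
  assert (Hr : (0 <= r < 3)%Z) by (apply Z.mod_pos_bound; lia).
  assert (Etau : tau = IZR r * (T / 3) + IZR j * T).
  { rewrite Kjr, plus_IZR, mult_IZR in Hk. lra. }
  assert (H' : forall t, eta2 t = eta1 (t + IZR r * (T / 3)) /\
                         eta3 t = eta1 (t + 2 * (IZR r * (T / 3)))).
  { intros x. destruct (H x) as (E2 & E3 & _). destruct (H (x + tau)) as (E2' & _ & _).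
    split.
    - rewrite E2, Etau, <- Rplus_assoc. apply eta1_period.
    - rewrite E3, E2', <- (eta1_period (2 * j) (x + _)), mult_IZR, Etau. f_equal. ring. }
  assert (Cr : r = 0%Z \/ r = 1%Z \/ r = 2%Z) by lia.
  destruct Cr as [Er|[Er|Er]]; rewrite Er in H'; clear Hr Kjr Etau.
  - exfalso. apply (v_neq0 (T / 4)); [lra|].
    rewrite v_eta. destruct (H' (T / 4)) as [-> ->]. rewrite !Rmult_0_l, Rmult_0_r. ring.
  - destruct (H' t) as [E2 E3]. rewrite Rmult_1_l in E2, E3. auto.
  - exfalso. destruct (H' (T / 12)) as [E2 E3].
    (* T/12 + 2T/3 = T - T/4 and T/12 + 4T/3 = T + 5T/12 *)
    replace (T / 12 + 2 * (T / 3)) with (- (T / 4) + IZR 1 * T) in E2 by field.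
    replace (T / 12 + 2 * (2 * (T / 3))) with (5 * T / 12 + IZR 1 * T) in E3 by field.
    rewrite eta1_period in E2, E3.
    pose proof (v_eta (T / 12)) as Ev. rewrite E2, E3 in Ev. unfold eta1 in Ev.
    rewrite Heven in Ev.
    destruct (mean_value_u (T / 4) (5 * T / 12)) as (x & Hx & E); [lra|].
    pose proof (v_same_sign (T / 12) x ltac:(lra) ltac:(lra)) as S.
    pose proof (u_pos (T / 12)) as U1. pose proof (u_pos (T / 4)) as U2.
    pose proof (u_pos (5 * T / 12)) as U3.
    assert (Ev' : v (T / 12) * (u (5 * T / 12) * u (T / 4))
                  = - (u (T / 12) * c * (v x * (5 * T / 12 - T / 4)))).
    { rewrite Ev, <- E. field. lra. }
    set (A := u (5 * T / 12) * u (T / 4)) in *.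
    assert (HA : 0 < A) by now apply Rmult_lt_0_compat.
    set (B := u (T / 12) * c * (5 * T / 12 - T / 4)).
    assert (HB : 0 < B) by (apply Rmult_lt_0_compat; [apply Rmult_lt_0_compat|]; lra).
    assert (EB : v (T / 12) * A = - (B * v x)) by (rewrite Ev'; unfold B; ring).
    assert (S1 : 0 < v (T / 12) * v x * A) by now apply Rmult_lt_0_compat.
    replace (v (T / 12) * v x * A) with (- (B * (v x * v x))) in S1
      by (replace (v (T / 12) * v x * A) with (v (T / 12) * A * v x) by ring; rewrite EB; ring).
    assert (0 <= B * (v x * v x)) by (apply Rmult_le_pos; [lra|apply Rle_0_sqr]).
    lra.
Qed.
End Orbit.

Theorem proposition6p1 :
  forall (c3 w1 : R) (w2 : C),
    0 < c3 < 1 / 27 ->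
    0 < w1 ->
    Re w2 = 0 -> 0 < Im w2 ->
    weierstrass_equation (RtoC w1) w2 (g2_of c3) (g3_of c3) ->
    (exists y1 y2 y3 : R -> R,
        given_by_formula c3 w1 w2 0 m_infty p_infty y1 y2 y3 /\
        flow_solution m_infty p_infty y1 y2 y3 /\
        conserved_value m_infty p_infty y1 y2 y3 c3)
    /\
    (forall (a b : Rbar) (y1 y2 y3 : R -> R) (t0 : R),
        flow_solution a b y1 y2 y3 ->
        in_interval a b t0 ->
        y1 t0 * y2 t0 * y3 t0 = c3 ->
        conserved_value a b y1 y2 y3 c3 /\
        exists s : R, given_by_formula c3 w1 w2 s a b y1 y2 y3).
Proof.
  intros c w1 w2 Hc Hw Hre Him HW.
  destruct w2 as [x0 b]. unfold Re, Im in Hre, Him; cbn in Hre, Him. subst x0.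
  destruct (wp_midline w1 b _ _ Hw Him HW) as (f & f' & Hf & Df & Df' & Q & Ev & Per & Min).
  set (T := 2 * w1) in *.
  set (u := fun t => 1 / 12 - f t). set (v := fun t => - f' t).
  assert (HT : 0 < T) by (unfold T; lra).
  assert (Hc0 : 0 < c) by lra.
  assert (Hu : forall t, is_derive u t (v t)).
  { intros t. evar_last.
    - apply (is_derive_minus (fun _ => 1 / 12) f t 0 (f' t)).
      + apply (is_derive_const (K := R_AbsRing) (V := R_NormedModule) (1 / 12)).
      + exact (Df t).
    - unfold v, minus, plus, opp; cbn. ring. }
  assert (Hv : forall t, is_derive v t (u t - c - 6 * (u t * u t))).
  { intros t. evar_last.
    - apply (is_derive_opp f' t _ (Df' t)).
    - unfold u, g2_of, opp; cbn. field. }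
  assert (Hq : forall t, v t * v t = (u t - c) * (u t - c) - 4 * (u t * u t * u t)).
  { intros t. unfold v. replace (- f' t * - f' t) with (f' t * f' t) by ring.
    rewrite Q. unfold u, g2_of, g3_of. field. }
  assert (He : forall t, u (- t) = u t) by (intros t; unfold u; now rewrite Ev).
  assert (Hp : forall t, u (t + T) = u t) by (intros t; unfold u; now rewrite Per).
  assert (Hm : forall q, 0 < q < T -> ~ (forall t, u (t + q) = u t)).
  { intros q Hq0 H. apply (Min q Hq0). intros t. specialize (H t). unfold u in H. lra. }
  assert (Hpos : forall t, 0 < u t) by (apply (u_pos c T u v); assumption).
  assert (Form : forall k x,
    y_formula c w1 (0, b) k ((0, b) + RtoC x)%C = RtoC (eta1 c u (x + INR k * (T / 3)))).
  { intros k x. unfold y_formula, eta1.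
    replace ((0, b) + RtoC x + RtoC (INR k * (2 / 3 * w1)))%C
      with ((0, b) + RtoC (x + INR k * (T / 3)))%C.
    2:{ rewrite <- Cplus_assoc, <- RtoC_plus. do 2 f_equal. unfold T. field. }
    rewrite Hf, <- RtoC_minus, <- RtoC_div; [reflexivity|].
    pose proof (Hpos (x + INR k * (T / 3))) as P0. unfold u in P0. lra. }
  assert (Third := eta_third c T u v Hc0 HT Hu Hv Hq He Hp Hm).
  assert (HF := eta_flow c T u v Hc0 HT Hu Hv Hq Hp).
  assert (Given : forall s lo hi y1 y2 y3,
    (forall t, in_interval lo hi t -> y1 t = eta1 c u (t + s) /\
       y2 t = eta2 c u v (t + s) /\ y3 t = eta3 c u v (t + s)) ->
    given_by_formula c w1 (0, b) (s - T / 3) lo hi y1 y2 y3).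
  { intros s lo hi y1 y2 y3 H t Ht. destruct (H t Ht) as (-> & -> & ->).
    destruct (Third (t + s)) as [-> ->]. rewrite !Form. cbn [INR].
    repeat split; do 2 f_equal; field. }
  split.
  - exists (fun t => eta1 c u (t + T / 3)), (fun t => eta2 c u v (t + T / 3)),
      (fun t => eta3 c u v (t + T / 3)).
    split; [|split].
    + pose proof (Given (T / 3) m_infty p_infty _ _ _
        (fun t _ => conj eq_refl (conj eq_refl eq_refl))) as G.
      replace (T / 3 - T / 3) with 0 in G by ring. exact G.
    + intros t _. destruct (HF (t + T / 3) (whole_line _)) as (D & D1 & D2 & D3).
      split; [exact D|]. split; [|split].
      * apply (is_derive_shift (eta1 c u) (T / 3) t _ D1).
      * apply (is_derive_shift (eta2 c u v) (T / 3) t _ D2).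
      * apply (is_derive_shift (eta3 c u v) (T / 3) t _ D3).
    + intros t _. apply (eta_product c T u v); assumption.
  - intros lo hi y1 y2 y3 t0 HFy H0 H3.
    pose proof (product_conserved _ _ _ _ _ _ HFy H0) as HC. rewrite H3 in HC.
    split; [exact HC|].
    destruct (flow_is_shift c T u v Hc0 HT Hu Hv Hq He Hp Hm lo hi y1 y2 y3 t0 HFy HC H0)
      as (s & Hs).
    exists (s - T / 3). now apply Given.
Qed.
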